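(* Refined normal form bisimilarity is strictly included in contextual equivalence: for all terms $t_0,t_1$, $t_0 \approx t_1$ implies $t_0\simeq_{\mathrm{ctx}} t_1$, and there exist terms that are contextually equivalent but not refined normal form bisimilar.
   Context: The calculus $\lambda_{\mathcal S}$. Terms: $t ::= x \mid \lambda x.t \mid t\,t \mid \mathcal{S}k.t \mid \langle t\rangle$; values: $v ::= \lambda x.t \mid x$. $\lambda x.t$ binds $x$ in $t$ and $\mathcal{S}k.t$ binds $k$ in $t$; terms up to $\alpha$-conversion; $\mathrm{fv}(t)$ free variables; $t\{v/x\}$ capture-avoiding substitution. Pure contexts: $F ::= [\,] \mid v\,F \mid F\,t$. Evaluation contexts: $E ::= [\,] \mid v\,E \mid E\,t \mid \langle E\rangle$. General contexts: $C ::= [\,] \mid \lambda x.C \mid t\,C \mid C\,t \mid \mathcal{S}k.C \mid \langle C\rangle$; $C[t]$ is hole-filling (possibly capturing). Reduction: $E[(\lambda x.t)\,v] \to E[t\{v/x\}]$; $E[\langle F[\mathcal{S}k.t]\rangle] \to E[\langle t\{\lambda x.\langle F[x]\rangle/k\}\rangle]$ with $x\notin\mathrm{fv}(F)$; $E[\langle v\rangle]\to E[v]$. $t\Downarrow t'$ means $t\to^*t'$ and $t'$ irreducible. Stuck: not a value and irreducible; normal form: value or stuck term; control stuck terms: $F[\mathcal{S}k.t]$; open stuck terms: $E[x\,v]$. Fresh: not occurring free in the terms/contexts under consideration. Contextual equivalence: $t_0 \simeq_{\mathrm{ctx}} t_1$ iff for every context $C$ with $C[t_0],C[t_1]$ closed,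 $C[t_0]$ evaluates to a value implies $C[t_1]$ evaluates to a value, $C[t_0]$ evaluates to a control stuck term implies $C[t_1]$ evaluates to a control stuck term, and symmetrically. Refined normal form bisimilarity. For a relation $\mathcal R$ on terms, extend it to evaluation contexts: $E_0 \mathrel{\mathcal R} E_1$ iff either $E_0 = E_0'[\langle F_0\rangle]$, $E_1 = E_1'[\langle F_1\rangle]$ with $F_0,F_1$ pure, $E_0'[x]\mathrel{\mathcal R}E_1'[x]$ and $\langle F_0[x]\rangle \mathrel{\mathcal R}\langle F_1[x]\rangle$ for fresh $x$; or $E_0=F_0$, $E_1=F_1$ pure with $F_0[x]\mathrel{\mathcal R}F_1[x]$ for fresh $x$. Let $v\mathbin{@}y$ be $x\,y$ if $v=x$ and $t\{y/x\}$ if $v=\lambda x.t$. Define $\mathcal R^{\mathrm{rnf}}$ on normal forms inductively: $v_0 \mathrel{\mathcal R^{\mathrm{rnf}}} v_1$ if $v_0\mathbin{@}x\mathrel{\mathcal R}v_1\mathbin{@}x$ for fresh $x$; $E_0[x\,v_0]\mathrel{\mathcal R^{\mathrm{rnf}}}E_1[x\,v_1]$ if $E_0\mathrel{\mathcal R}E_1$ and $v_0\mathrel{\mathcal R^{\mathrm{rnf}}}v_1$; $F_0[\mathcal{S}k.t_0]\mathrel{\mathcal R^{\mathrm{rnf}}}F_1[\mathcal{S}k.t_1]$ if $\langle t_0\{\lambda x.\langle k'\,F_0[x]\rangle/k\}\rangle \mathrel{\mathcal R}\langle t_1\{\lambda x.\langle k'\,F_1[x]\rangle/k\}\rangle$ for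 fresh $k',x$. $\mathcal R$ is a refined normal form simulation if $t_0\mathrel{\mathcal R}t_1$ and $t_0\Downarrow t_0'$ imply $t_1\Downarrow t_1'$ with $t_0'\mathrel{\mathcal R^{\mathrm{rnf}}}t_1'$; a refined bisimulation if $\mathcal R$ and its inverse are refined simulations. $\approx$ denotes the largest refined normal form bisimulation. *)

(* Defs.v *)
(* The calculus lambda_S (shift/reset, CBV) in locally nameless
   representation: free variables are named atoms (nat), bound variables are
   de Bruijn indices; preterms quotiented by alpha-conversion are exactly the
   locally closed preterms. *)
From Stdlib Require Import List Arith Relations.
Import ListNotations.

Inductive term : Type :=
| fvar (x : nat)
| bvar (n : nat)
| lam (t : term)
| app (t u : term)
| shift (t : term)        (* S k.t, binds bvar 0 in t *)
| reset (t : term).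

Fixpoint fv (t : term) : list nat :=
  match t with
  | fvar x => [x]
  | bvar _ => []
  | lam t => fv t
  | app t u => fv t ++ fv u
  | shift t => fv t
  | reset t => fv t
  end.

Fixpoint lc_at (k : nat) (t : term) : Prop :=
  match t with
  | fvar _ => True
  | bvar n => n < k
  | lam t => lc_at (S k) t
  | app t u => lc_at k t /\ lc_at k u
  | shift t => lc_at (S k) t
  | reset t => lc_at k t
  end.

Definition lc (t : term) : Prop := lc_at 0 t.

Definition closed (t : term) : Prop := lc t /\ fv t = [].

Fixpoint open_rec (k : nat) (u : term) (t : term) : term :=
  match t with
  | fvar x => fvar x
  | bvar n => if Nat.eqb n k then u else bvar n
  | lam t => lam (open_rec (S k) u t)
  | app t1 t2 => app (open_rec k u t1) (open_rec k u t2)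
  | shift t => shift (open_rec (S k) u t)
  | reset t => reset (open_rec k u t)
  end.

Definition open (t u : term) : term := open_rec 0 u t.

Fixpoint close_rec (k : nat) (x : nat) (t : term) : term :=
  match t with
  | fvar y => if Nat.eqb y x then bvar k else fvar y
  | bvar n => bvar n
  | lam t => lam (close_rec (S k) x t)
  | app t1 t2 => app (close_rec k x t1) (close_rec k x t2)
  | shift t => shift (close_rec (S k) x t)
  | reset t => reset (close_rec k x t)
  end.

Definition close (x : nat) (t : term) : term := close_rec 0 x t.

Definition is_value (t : term) : Prop :=
  match t with
  | lam _ => True
  | fvar _ => True
  | _ => False
  end.

Inductive ectx : Type :=
| Ehole
| EappR (v : term) (E : ectx)
| EappL (E : ectx) (t : term)
| Ereset (E : ectx).

Fixpoint eplug (E : ectx) (t : term) : term :=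
  match E with
  | Ehole => t
  | EappR v E => app v (eplug E t)
  | EappL E u => app (eplug E t) u
  | Ereset E => reset (eplug E t)
  end.

Fixpoint ecomp (E1 E2 : ectx) : ectx :=
  match E1 with
  | Ehole => E2
  | EappR v E => EappR v (ecomp E E2)
  | EappL E u => EappL (ecomp E E2) u
  | Ereset E => Ereset (ecomp E E2)
  end.

Fixpoint fv_ctx (E : ectx) : list nat :=
  match E with
  | Ehole => []
  | EappR v E => fv v ++ fv_ctx E
  | EappL E u => fv_ctx E ++ fv u
  | Ereset E => fv_ctx E
  end.

Fixpoint ectx_ok (E : ectx) : Prop :=
  match E with
  | Ehole => True
  | EappR v E => is_value v /\ ectx_ok E
  | EappL E _ => ectx_ok E
  | Ereset E => ectx_ok E
  end.

Fixpoint pure (F : ectx) : Prop :=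
  match F with
  | Ehole => True
  | EappR v F => is_value v /\ pure F
  | EappL F _ => pure F
  | Ereset _ => False
  end.

Definition capture (F : ectx) : term := lam (reset (eplug F (bvar 0))).

Inductive step : term -> term -> Prop :=
| step_beta : forall E t v, ectx_ok E -> is_value v ->
    step (eplug E (app (lam t) v)) (eplug E (open t v))
| step_shift : forall E F t, ectx_ok E -> pure F ->
    step (eplug E (reset (eplug F (shift t))))
         (eplug E (reset (open t (capture F))))
| step_reset : forall E v, ectx_ok E -> is_value v ->
    step (eplug E (reset v)) (eplug E v).

Definition irreducible (t : term) : Prop := ~ exists t', step t t'.

Definition eval (t t' : term) : Prop :=
  clos_refl_trans term step t t' /\ irreducible t'.

Definition control_stuck (t : term) : Prop :=
  exists F u, pure F /\ t = eplug F (shift u).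

Definition evals_to_value (t : term) : Prop :=
  exists v, eval t v /\ is_value v.

Definition evals_to_control_stuck (t : term) : Prop :=
  exists u, eval t u /\ control_stuck u.

(* general contexts C ::= [] | \x.C | t C | C t | S k.C | <C>;
   the binders carry names so that hole filling may capture *)
Inductive gctx : Type :=
| Chole
| Clam (x : nat) (C : gctx)
| CappR (t : term) (C : gctx)
| CappL (C : gctx) (t : term)
| Cshift (k : nat) (C : gctx)
| Creset (C : gctx).

Fixpoint cplug (C : gctx) (t : term) : term :=
  match C with
  | Chole => t
  | Clam x C => lam (close x (cplug C t))
  | CappR u C => app u (cplug C t)
  | CappL C u => app (cplug C t) u
  | Cshift k C => shift (close k (cplug C t))
  | Creset C => reset (cplug C t)
  end.

Definition ctx_equiv (t0 t1 : term) : Prop :=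
  forall C, closed (cplug C t0) -> closed (cplug C t1) ->
    (evals_to_value (cplug C t0) <-> evals_to_value (cplug C t1)) /\
    (evals_to_control_stuck (cplug C t0) <-> evals_to_control_stuck (cplug C t1)).

Definition rel := term -> term -> Prop.

Definition vapp (v : term) (y : nat) : term :=
  match v with
  | fvar x => app (fvar x) (fvar y)
  | lam t => open t (fvar y)
  | _ => app v (fvar y)
  end.

Definition ctx_rel (R : rel) (E0 E1 : ectx) : Prop :=
  (exists E0' F0 E1' F1,
      ectx_ok E0' /\ pure F0 /\ ectx_ok E1' /\ pure F1 /\
      E0 = ecomp E0' (Ereset F0) /\ E1 = ecomp E1' (Ereset F1) /\
      forall x, ~ In x (fv_ctx E0 ++ fv_ctx E1) ->
        R (eplug E0' (fvar x)) (eplug E1' (fvar x)) /\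
        R (reset (eplug F0 (fvar x))) (reset (eplug F1 (fvar x))))
  \/
  (pure E0 /\ pure E1 /\
   forall x, ~ In x (fv_ctx E0 ++ fv_ctx E1) ->
     R (eplug E0 (fvar x)) (eplug E1 (fvar x))).

Inductive rnf (R : rel) : term -> term -> Prop :=
| rnf_val : forall v0 v1, is_value v0 -> is_value v1 ->
    (forall x, ~ In x (fv v0 ++ fv v1) -> R (vapp v0 x) (vapp v1 x)) ->
    rnf R v0 v1
| rnf_open : forall E0 E1 x v0 v1, ectx_ok E0 -> ectx_ok E1 ->
    is_value v0 -> is_value v1 ->
    ctx_rel R E0 E1 -> rnf R v0 v1 ->
    rnf R (eplug E0 (app (fvar x) v0)) (eplug E1 (app (fvar x) v1))
| rnf_ctrl : forall F0 F1 t0 t1, pure F0 -> pure F1 ->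
    (forall k', ~ In k' (fv_ctx F0 ++ fv t0 ++ fv_ctx F1 ++ fv t1) ->
       R (reset (open t0 (lam (reset (app (fvar k') (eplug F0 (bvar 0)))))))
         (reset (open t1 (lam (reset (app (fvar k') (eplug F1 (bvar 0)))))))) ->
    rnf R (eplug F0 (shift t0)) (eplug F1 (shift t1)).

Definition rnf_simulation (R : rel) : Prop :=
  forall t0 t1 t0', R t0 t1 -> eval t0 t0' ->
    exists t1', eval t1 t1' /\ rnf R t0' t1'.

Definition rnf_bisimulation (R : rel) : Prop :=
  rnf_simulation R /\ rnf_simulation (fun a b => R b a).

Definition rnf_bisim (t0 t1 : term) : Prop :=
  exists R, rnf_bisimulation R /\ R t0 t1.

(* Main.v *)
From Stdlib Require Import List Arith Lia Relations Classical.
Require Import Defs.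
Import ListNotations.

(** Soundness. A simulation [R] is closed into a relation [cl R] under term
constructors, plugging into related contexts, expansion on the right, and
simultaneous substitution. By induction on the number of steps [n] and then on
the derivation of [cl R t0 t1], if [t0] reaches a normal form within [n] steps
then so does [t1], with related normal forms. Two points need care.
- When [F[Sk.t]] gets delimited by [<G[]>], the bisimulation only knows
  [t{\x.<k' F[x]>/k}], whereas [t{\x.<G[F[x]]>/k}] is needed. Replacing [k']
  by the value [\y.<G[y]>] would change the number of steps, so substitution
  also replaces frames: [<k' u>] becomes [<G[u]>].
- Testing values by [v @ x] makes the relation extensional: a variable may be
  related to an infinite eta-expansion of itself, and no step of the left-hand
  term pays for unfolding it. Hence the relation between a variable and a value
  is defined coinductively and shown closed under composition separately, while
  a substituted abstraction consumes a beta step and so decreases [n].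
Strictness. [x Omega] and [<x x> Omega] are equivalent, because in a closed
program [<x x>] can only diverge or return a value, after which [Omega] runs;
but as open terms the first diverges and the second is stuck. *)

(** * Contexts, local closure, and determinism of reduction *)

Notation star := (clos_refl_trans term step).

Fixpoint lc_ctx (E : ectx) : Prop :=
  match E with
  | Ehole => True
  | EappR v E => lc v /\ lc_ctx E
  | EappL E u => lc_ctx E /\ lc u
  | Ereset E => lc_ctx E
  end.

(** A class stable under reduction that contains no control stuck term. Such a term can be placed in
    a context with resets without ever capturing a part of that context. *)
Definition delimited (t : term) : Prop :=
  match t with
  | lam _ | fvar _ | reset _ => True
  | _ => False
  end.

Lemma fresh_exists (L : list nat) : exists x, ~ In x L.
Proof.
  exists (S (list_max L)). intro H.
  assert (H1 := proj1 (list_max_le L (list_max L)) (le_n _)).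
  rewrite Forall_forall in H1. apply H1 in H. lia.
Qed.

Lemma eplug_ecomp E1 E2 t : eplug (ecomp E1 E2) t = eplug E1 (eplug E2 t).
Proof. induction E1; simpl; congruence. Qed.

Lemma ecomp_assoc E1 E2 E3 :
  ecomp (ecomp E1 E2) E3 = ecomp E1 (ecomp E2 E3).
Proof. induction E1; simpl; congruence. Qed.

Lemma ecomp_hole E : ecomp E Ehole = E.
Proof. induction E; simpl; congruence. Qed.

Lemma ectx_ok_ecomp E1 E2 : ectx_ok (ecomp E1 E2) <-> ectx_ok E1 /\ ectx_ok E2.
Proof. induction E1; simpl; tauto. Qed.

Lemma pure_ok F : pure F -> ectx_ok F.
Proof. induction F; simpl; tauto. Qed.

Lemma pure_ecomp F G : pure (ecomp F G) <-> pure F /\ pure G.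
Proof. induction F; simpl; tauto. Qed.

Lemma lc_ctx_ecomp E1 E2 : lc_ctx (ecomp E1 E2) <-> lc_ctx E1 /\ lc_ctx E2.
Proof. induction E1; simpl; tauto. Qed.

Lemma in_fv_ecomp x E1 E2 :
  In x (fv_ctx (ecomp E1 E2)) <-> In x (fv_ctx E1) \/ In x (fv_ctx E2).
Proof. induction E1; simpl; rewrite ?in_app_iff; tauto. Qed.

Lemma lc_at_weaken t j k : j <= k -> lc_at j t -> lc_at k t.
Proof.
  revert j k; induction t; simpl; intros j k Hjk H; eauto; try lia.
  - apply (IHt (S j)); auto; lia.
  - destruct H; eauto.
  - apply (IHt (S j)); auto; lia.
Qed.

Lemma lc_lc_at t k : lc t -> lc_at k t.
Proof. apply lc_at_weaken; lia. Qed.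

Lemma lc_at_eplug k E t : lc_ctx E -> lc_at k t -> lc_at k (eplug E t).
Proof.
  induction E; simpl; intuition auto using lc_lc_at.
Qed.

Lemma lc_eplug E t : lc (eplug E t) <-> lc_ctx E /\ lc t.
Proof.
  unfold lc; induction E; simpl; fold lc in *; unfold lc in *; tauto.
Qed.

Lemma open_rec_lc_at t j k u : j <= k -> lc_at j t -> open_rec k u t = t.
Proof.
  revert j k; induction t; simpl; intros j k Hjk H; auto.
  - destruct (Nat.eqb_spec n k); auto; lia.
  - f_equal; apply (IHt (S j)); auto; lia.
  - destruct H; f_equal; eauto.
  - f_equal; apply (IHt (S j)); auto; lia.
  - f_equal; eauto.
Qed.

Lemma open_rec_lc t k u : lc t -> open_rec k u t = t.
Proof. apply open_rec_lc_at; lia. Qed.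

Lemma open_rec_eplug F k u t :
  lc_ctx F -> open_rec k u (eplug F t) = eplug F (open_rec k u t).
Proof.
  induction F; simpl; intros H; auto; try (destruct H);
  f_equal; auto using open_rec_lc.
Qed.

Lemma lc_at_open_rec t k u : lc_at (S k) t -> lc u -> lc_at k (open_rec k u t).
Proof.
  revert k; induction t; simpl; intros k H Hu; auto; try tauto.
  - destruct (Nat.eqb_spec n k); [apply lc_lc_at; auto | simpl; lia].
  - split; [apply IHt1 | apply IHt2]; tauto.
Qed.

Lemma lc_open t u : lc (lam t) -> lc u -> lc (open t u).
Proof. apply lc_at_open_rec. Qed.

Lemma lc_at_close t k x : lc_at k t -> lc_at (S k) (close_rec k x t).
Proof.
  revert k; induction t; simpl; intros k H; auto.
  - destruct (Nat.eqb x0 x); simpl; auto; lia.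
  - destruct H; auto.
Qed.

Lemma lc_capture F : lc_ctx F -> lc (capture F).
Proof. intro; simpl; apply lc_at_eplug; simpl; auto. Qed.

Lemma step_lc t t' : step t t' -> lc t -> lc t'.
Proof.
  destruct 1; rewrite !lc_eplug; intros [HE Ht]; split; auto.
  - destruct Ht; apply lc_open; auto.
  - change (lc (eplug F (shift t))) in Ht. apply lc_eplug in Ht as [HF Ht].
    change (lc (open t (capture F))). apply lc_open; auto using lc_capture.
Qed.

Lemma star_lc t t' : star t t' -> lc t -> lc t'.
Proof. induction 1; eauto using step_lc. Qed.

Lemma step_eplug E t t' : ectx_ok E -> step t t' -> step (eplug E t) (eplug E t').
Proof.
  intros HE; destruct 1; rewrite <- !eplug_ecomp; constructor; auto;
  apply ectx_ok_ecomp; auto.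
Qed.

Lemma star_eplug E t t' : ectx_ok E -> star t t' -> star (eplug E t) (eplug E t').
Proof.
  induction 2; [apply rt_step; auto using step_eplug | apply rt_refl | eapply rt_trans; eauto].
Qed.

Lemma step_beta_top t v : is_value v -> step (app (lam t) v) (open t v).
Proof. apply (step_beta Ehole); exact I. Qed.

Lemma step_app_inv a b t' : step (app a b) t' ->
  (exists t, a = lam t /\ is_value b /\ t' = open t b) \/
  (exists a', step a a' /\ t' = app a' b) \/
  (is_value a /\ exists b', step b b' /\ t' = app a b').
Proof.
  intro H; inversion H as [E t v HE Hv e | E F t HE HF e | E v HE Hv e];
  destruct E; simpl in *; inversion e; subst; try (destruct HE).
  - left; eauto.
  - right; right; split; auto. eexists; split; eauto using step_beta.
  - right; left; eexists; split; eauto using step_beta.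
  - right; right; split; auto. eexists; split; eauto using step_shift.
  - right; left; eexists; split; eauto using step_shift.
  - right; right; split; auto. eexists; split; eauto using step_reset.
  - right; left; eexists; split; eauto using step_reset.
Qed.

Lemma step_reset_inv a t' : step (reset a) t' ->
  (is_value a /\ t' = a) \/
  (exists F t, pure F /\ a = eplug F (shift t) /\ t' = reset (open t (capture F))) \/
  (exists a', step a a' /\ t' = reset a').
Proof.
  intro H; inversion H as [E t v HE Hv e | E F t HE HF e | E v HE Hv e];
  destruct E; simpl in *; inversion e; subst.
  - right; right; eexists; split; eauto using step_beta.
  - right; left; eauto.
  - right; right; eexists; split; eauto using step_shift.
  - left; auto.
  - right; right; eexists; split; eauto using step_reset.
Qed.

Lemma irreducible_value v : is_value v -> irreducible v.
Proof.
  intros Hv [t' H]; destruct H; destruct E; simpl in Hv; tauto.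
Qed.

Lemma irreducible_ctrl F t : pure F -> irreducible (eplug F (shift t)).
Proof.
  induction F; simpl; intros HF [t' H].
  - inversion H; destruct E; discriminate.
  - destruct HF as [Hv HF].
    apply step_app_inv in H as [(s & -> & H & _) | [(a' & H & _) | (_ & b' & H & _)]].
    + destruct F; simpl in H; auto.
    + eapply irreducible_value; eauto.
    + eapply IHF; eauto.
  - apply step_app_inv in H as [(s & H & _) | [(a' & H & _) | (H & _)]].
    + destruct F; discriminate.
    + eapply IHF; eauto.
    + destruct F; simpl in H; auto.
  - tauto.
Qed.

Lemma open_not_ctrl E x v F t : pure F ->
  eplug E (app (fvar x) v) = eplug F (shift t) ->
  is_value v -> ectx_ok E -> False.
Proof.
  revert F; induction E; intros F HF e Hv HE; destruct F; simpl in *;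
    try discriminate; inversion e; subst; try tauto.
  - destruct F; simpl in Hv; tauto.
  - destruct F; discriminate.
  - destruct HF, HE; eauto.
  - destruct HE as [HE _]. destruct F; simpl in HE; tauto.
  - destruct HF as [HF _]. destruct E; simpl in HF; tauto.
  - eauto.
Qed.

Lemma irreducible_open E x v : ectx_ok E -> is_value v ->
  irreducible (eplug E (app (fvar x) v)).
Proof.
  intros HE Hv; induction E; simpl in *; intros [t' H].
  - apply step_app_inv in H as [(s & H & _) | [(a' & H & _) | (_ & b' & H & _)]].
    + discriminate.
    + exact (irreducible_value (fvar x) I (ex_intro _ a' H)).
    + eapply irreducible_value; eauto.
  - destruct HE as [Hv0 HE].
    apply step_app_inv in H as [(s & -> & H & _) | [(a' & H & _) | (_ & b' & H & _)]].
    + destruct E; simpl in H; auto.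
    + eapply (irreducible_value v0); eauto.
    + eapply IHE; eauto.
  - apply step_app_inv in H as [(s & H & _) | [(a' & H & _) | (H & _)]].
    + destruct E; discriminate.
    + eapply IHE; eauto.
    + destruct E; simpl in H; auto.
  - apply step_reset_inv in H as [(H & _) | [(F & t & HF & e & _) | (a' & H & _)]].
    + destruct E; simpl in H; auto.
    + eapply open_not_ctrl; eauto.
    + eapply IHE; eauto.
Qed.

Lemma ctrl_inj F G t u : pure F -> pure G ->
  eplug F (shift t) = eplug G (shift u) -> F = G /\ t = u.
Proof.
  revert G; induction F; intros G HF HG e; destruct G; simpl in *;
    try discriminate; inversion e; subst; try tauto.
  - destruct HF, HG. edestruct IHF as [-> ->]; eauto.
  - destruct HF as [HF _]; destruct G; simpl in HF; tauto.
  - destruct HG as [HG _]; destruct F; simpl in HG; tauto.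
  - edestruct IHF as [-> ->]; eauto.
Qed.

Lemma value_no_step v t : is_value v -> step v t -> False.
Proof. intros H Hs; apply (irreducible_value v H); eauto. Qed.

Lemma ctrl_no_step F t t' : pure F -> step (eplug F (shift t)) t' -> False.
Proof. intros H Hs; apply (irreducible_ctrl F t H); eauto. Qed.

Lemma ctrl_not_value F t : is_value (eplug F (shift t)) -> False.
Proof. destruct F; simpl; auto. Qed.

Lemma open_not_value E x v : is_value (eplug E (app (fvar x) v)) -> False.
Proof. destruct E; simpl; auto. Qed.

Lemma step_det t t1 t2 : step t t1 -> step t t2 -> t1 = t2.
Proof.
  revert t1 t2; induction t; intros t1' t2' H1 H2;
  try (inversion H1; destruct E; discriminate).
  - apply step_app_inv in H1 as [(s & -> & H1 & ->) | [(a' & H1 & ->) | (Hv & b' & H1 & ->)]];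
    apply step_app_inv in H2 as [(s' & e & H2 & ->) | [(a'' & H2 & ->) | (Hv' & b'' & H2 & ->)]];
    subst; try (f_equal; auto; fail);
    try (now inversion e);
    exfalso; match goal with H : step ?v _ |- _ =>
      solve [apply (value_no_step v) in H; simpl; auto] end.
  - apply step_reset_inv in H1 as [(H1 & ->) | [(F & s & HF & -> & ->) | (a' & H1 & ->)]];
    apply step_reset_inv in H2 as [(H2 & ->) | [(G & s' & HG & e & ->) | (a'' & H2 & ->)]];
    subst; auto; try (f_equal; auto; fail);
    try (apply ctrl_inj in e as [-> ->]; auto; fail);
    exfalso; eauto using value_no_step, ctrl_no_step, ctrl_not_value.
Qed.

(** * Counted reduction sequences *)

Inductive nsteps : nat -> term -> term -> Prop :=
| nsteps_O t : nsteps 0 t t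
| nsteps_S n t t' t'' : step t t' -> nsteps n t' t'' -> nsteps (S n) t t''.

Lemma star_nsteps t t' : star t t' -> exists n, nsteps n t t'.
Proof.
  intro H; apply clos_rt_rt1n in H; induction H as [|? ? ? ? ? [n IH]].
  - exists 0; constructor.
  - exists (S n); econstructor; eauto.
Qed.

Lemma nsteps_star n t t' : nsteps n t t' -> star t t'.
Proof.
  induction 1; [apply rt_refl | eapply rt_trans; [apply rt_step|]; eauto].
Qed.

Lemma nsteps_irreducible n t t' : irreducible t -> nsteps n t t' -> n = 0 /\ t' = t.
Proof. intros H; destruct 1; auto. exfalso; apply H; eauto. Qed.

Lemma eval_star t t' r : star t t' -> eval t' r -> eval t r.
Proof. intros H [H1 H2]; split; auto; eapply rt_trans; eauto. Qed.

Lemma eval_refl t : irreducible t -> eval t t.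
Proof. split; [apply rt_refl | auto]. Qed.

(** By determinism every run of [E[t]] begins with the steps of [t], for as long as [t] can move.
    The intermediate [r'] is irreducible but need not be a value. *)
Lemma nsteps_eplug_inv n E t r : ectx_ok E -> nsteps n (eplug E t) r -> irreducible r ->
  exists m r', m <= n /\ nsteps m t r' /\ irreducible r' /\ nsteps (n - m) (eplug E r') r.
Proof.
  intro HE; revert t; induction n; intros t H Hr;
  (destruct (classic (exists t', step t t')) as [[t' Ht] | Ht];
   [| exists 0, t; split; [lia|]; split; [constructor|]; split; auto; rewrite Nat.sub_0_r; auto]).
  - inversion H; subst. exfalso; apply Hr; eauto using step_eplug.
  - inversion H as [|? ? s ? Hs Hn]; subst.
    rewrite (step_det _ _ _ Hs (step_eplug _ _ _ HE Ht)) in Hn.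
    destruct (IHn _ Hn Hr) as (m & r' & Hm & H1 & H2 & H3).
    exists (S m), r'; split; [lia|]; split; [econstructor; eauto|]; auto.
Qed.

Lemma delimited_step t t' : step t t' -> delimited t -> delimited t'.
Proof.
  intros H Hd; destruct t; simpl in Hd; try tauto.
  - exfalso; apply (irreducible_value (fvar x) I); eauto.
  - exfalso; apply (irreducible_value (lam t) I); eauto.
  - apply step_reset_inv in H as [(H & ->) | [(F & u & _ & _ & ->) | (a' & _ & ->)]];
    simpl; auto. destruct t; simpl in *; auto.
Qed.

Lemma delimited_star t t' : star t t' -> delimited t -> delimited t'.
Proof. induction 1; eauto using delimited_step. Qed.

(** * Substitution of values and of frames *)

Inductive repl : Type :=
| RV (v : term)
| RF (F : ectx).

(* [sb rho] is the graph of a partial function: a variable [y] with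
   [rho y = RF F] may only occur as [<y t>], which becomes [<F[t]>]. *)
Inductive sb (rho : nat -> repl) : term -> term -> Prop :=
| sb_fvar y v : rho y = RV v -> sb rho (fvar y) v
| sb_bvar n : sb rho (bvar n) (bvar n)
| sb_lam t u : sb rho t u -> sb rho (lam t) (lam u)
| sb_app t u t' u' : sb rho t t' -> sb rho u u' -> sb rho (app t u) (app t' u')
| sb_shift t u : sb rho t u -> sb rho (shift t) (shift u)
| sb_reset t u : sb rho t u -> sb rho (reset t) (reset u)
| sb_frame y F t u : rho y = RF F -> sb rho t u ->
    sb rho (reset (app (fvar y) t)) (reset (eplug F u)).

(** The hole may lie in the argument of a replaced [y], and then [F] is inserted above it. A pattern
    [<y a>] that is split by the hole, as in [<[]>] filled with [y a], is not covered, hence the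
    second alternative of [sb_eplug_inv]. *)
Inductive sbE (rho : nat -> repl) : ectx -> ectx -> Prop :=
| sbE_hole : sbE rho Ehole Ehole
| sbE_appR v v' E E' : sb rho v v' -> sbE rho E E' -> sbE rho (EappR v E) (EappR v' E')
| sbE_appL u u' E E' : sb rho u u' -> sbE rho E E' -> sbE rho (EappL E u) (EappL E' u')
| sbE_reset E E' : sbE rho E E' -> sbE rho (Ereset E) (Ereset E')
| sbE_frame y F E E' : rho y = RF F -> sbE rho E E' ->
    sbE rho (Ereset (EappR (fvar y) E)) (Ereset (ecomp F E')).

Definition repl_wf (r : repl) : Prop :=
  match r with
  | RV v => is_value v /\ lc v
  | RF F => pure F /\ lc_ctx F
  end.

Definition idr : nat -> repl := fun y => RV (fvar y).

Definition upd (rho : nat -> repl) (x : nat) (r : repl) : nat -> repl :=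
  fun y => if Nat.eqb y x then r else rho y.

Lemma upd_eq rho x r : upd rho x r x = r.
Proof. unfold upd; now rewrite Nat.eqb_refl. Qed.

Lemma upd_neq rho x r y : y <> x -> upd rho x r y = rho y.
Proof. unfold upd; intro H; now apply Nat.eqb_neq in H as ->. Qed.

Lemma upd_wf rho x r : (forall y, repl_wf (rho y)) -> repl_wf r ->
  forall y, repl_wf (upd rho x r y).
Proof. intros H Hr y; unfold upd; destruct (Nat.eqb y x); auto. Qed.

Lemma idr_wf y : repl_wf (idr y).
Proof. split; exact I. Qed.

Lemma sb_idr t : sb idr t t.
Proof. induction t; constructor; auto. Qed.

Lemma sbE_idr E : sbE idr E E.
Proof. induction E; constructor; auto using sb_idr. Qed.

Lemma sb_agree rho rho' t u : sb rho t u ->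
  (forall y, In y (fv t) -> rho y = rho' y) -> sb rho' t u.
Proof.
  induction 1; simpl; intros Hag; try (constructor; auto; fail).
  - constructor; rewrite <- H; symmetry; auto.
  - constructor; [apply IHsb1 | apply IHsb2]; intros; apply Hag, in_app_iff; auto.
  - eapply sb_frame; eauto. rewrite <- H; symmetry; auto.
Qed.

Lemma sbE_agree rho rho' E E' : sbE rho E E' ->
  (forall y, In y (fv_ctx E) -> rho y = rho' y) -> sbE rho' E E'.
Proof.
  induction 1; simpl; intros Hag; try (constructor; auto; fail).
  - constructor; [eapply sb_agree; eauto | apply IHsbE];
    intros; apply Hag, in_app_iff; auto.
  - constructor; [eapply sb_agree; eauto | apply IHsbE];
    intros; apply Hag, in_app_iff; auto.
  - apply sbE_frame; auto. rewrite <- H; symmetry; auto.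
Qed.

Lemma sb_upd rho x r t u : sb rho t u -> ~ In x (fv t) -> sb (upd rho x r) t u.
Proof.
  intros H Hx; eapply sb_agree; eauto.
  intros y Hy; rewrite upd_neq; auto; congruence.
Qed.

Lemma sbE_upd rho x r E E' : sbE rho E E' -> ~ In x (fv_ctx E) -> sbE (upd rho x r) E E'.
Proof.
  intros H Hx; eapply sbE_agree; eauto.
  intros y Hy; rewrite upd_neq; auto; congruence.
Qed.

Lemma sb_upd_fvar rho x v : sb (upd rho x (RV v)) (fvar x) v.
Proof. constructor; apply upd_eq. Qed.

Lemma sb_eplug rho E E' t u : sbE rho E E' -> sb rho t u ->
  sb rho (eplug E t) (eplug E' u).
Proof.
  intros HE Ht; induction HE; simpl; auto; try (constructor; auto; fail).
  rewrite eplug_ecomp. eapply sb_frame; eauto.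
Qed.

Lemma sb_subst x v E : ~ In x (fv_ctx E) ->
  sb (upd idr x (RV v)) (eplug E (fvar x)) (eplug E v).
Proof.
  intros; apply sb_eplug; auto using sb_upd_fvar, sbE_upd, sbE_idr.
Qed.

Lemma sb_open_rec rho a b : (forall y, repl_wf (rho y)) -> sb rho a b ->
  forall t u k, sb rho t u -> sb rho (open_rec k a t) (open_rec k b u).
Proof.
  intros Hwf Hab t u k H; revert k; induction H; intro k; simpl;
    try (constructor; auto; fail).
  - rewrite open_rec_lc; [constructor; auto|].
    generalize (Hwf y); rewrite H; simpl; tauto.
  - destruct (Nat.eqb n k); auto; constructor.
  - rewrite open_rec_eplug; [eapply sb_frame; eauto|].
    generalize (Hwf y); rewrite H; simpl; tauto.
Qed.

Lemma sb_open rho a b t u : (forall y, repl_wf (rho y)) -> sb rho a b ->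
  sb rho t u -> sb rho (open t a) (open u b).
Proof. intros; apply sb_open_rec; auto. Qed.

Lemma sb_open_upd rho z a t u : (forall y, repl_wf (rho y)) -> is_value a -> lc a ->
  ~ In z (fv t) -> sb rho t u ->
  sb (upd rho z (RV a)) (open t (fvar z)) (open u a).
Proof.
  intros; apply sb_open; auto using sb_upd_fvar, sb_upd.
  apply upd_wf; simpl; auto.
Qed.

Lemma sb_lc rho t u : (forall y, repl_wf (rho y)) -> sb rho t u ->
  forall k, lc_at k t -> lc_at k u.
Proof.
  intros Hwf; induction 1; simpl; intros k; auto.
  - generalize (Hwf y); rewrite H; simpl; intros [_ Hv] _; auto using lc_lc_at.
  - intuition.
  - intros [_ Ht]. apply lc_at_eplug; auto.
    generalize (Hwf y); rewrite H; simpl; tauto.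
Qed.

Lemma sb_value rho v w : (forall y, repl_wf (rho y)) -> sb rho v w ->
  is_value v -> is_value w.
Proof.
  intros Hwf; destruct 1; simpl; auto.
  generalize (Hwf y); rewrite H; simpl; tauto.
Qed.

Lemma sbE_ok rho E E' : (forall y, repl_wf (rho y)) -> sbE rho E E' ->
  ectx_ok E -> ectx_ok E'.
Proof.
  intros Hwf; induction 1; simpl; intuition eauto using sb_value.
  apply ectx_ok_ecomp; split; auto. apply pure_ok.
  generalize (Hwf y); rewrite H; simpl; tauto.
Qed.

Lemma sbE_pure rho E E' : (forall y, repl_wf (rho y)) -> sbE rho E E' ->
  pure E -> pure E'.
Proof.
  intros Hwf; induction 1; simpl; intuition eauto using sb_value.
Qed.

(** A frame is inserted directly below a reset that stays in place, so what follows this reset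
    remains pure. *)
Lemma sbE_reset_inv rho F E : (forall y, repl_wf (rho y)) -> pure F ->
  sbE rho (Ereset F) E -> exists F', pure F' /\ E = Ereset F'.
Proof.
  intros Hwf HF H; inversion H; subst; simpl in *.
  - eexists; split; [eapply sbE_pure; eauto | auto].
  - eexists; split; [|eauto]. apply pure_ecomp; split.
    + generalize (Hwf y); rewrite H1; simpl; tauto.
    + eapply sbE_pure; eauto; tauto.
Qed.

(** Splitting just before a reset is safe; a split between a reset and the frame [y []] below it
    could cut a replaced pattern in two. *)
Lemma sbE_ecomp_reset_inv rho E1 E2 E : sbE rho (ecomp E1 (Ereset E2)) E ->
  exists E1' E2', sbE rho E1 E1' /\ sbE rho (Ereset E2) E2' /\ E = ecomp E1' E2'.
Proof.
  intro H; remember (ecomp E1 (Ereset E2)) as E0 eqn:e; revert E1 e.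
  induction H; intros E1 e.
  - destruct E1; discriminate.
  - destruct E1; inversion e; subst.
    edestruct IHsbE as (A & B & HA & HB & ->); eauto.
    exists (EappR v' A), B; repeat split; auto; constructor; auto.
  - destruct E1; inversion e; subst.
    edestruct IHsbE as (A & B & HA & HB & ->); eauto.
    exists (EappL A u'), B; repeat split; auto; constructor; auto.
  - destruct E1; inversion e; subst.
    + exists Ehole, (Ereset E'); repeat split; constructor; auto.
    + edestruct IHsbE as (A & B & HA & HB & ->); eauto.
      exists (Ereset A), B; repeat split; auto; constructor; auto.
  - destruct E1 as [| | | E1]; inversion e; subst.
    + exists Ehole, (Ereset (ecomp F E')); repeat split; [constructor | eapply sbE_frame; eauto].
    + destruct E1 as [| ? E1 | |]; inversion H2; subst.
      edestruct IHsbE as (A & B & HA & HB & ->); eauto.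
      exists (Ereset (ecomp F A)), B; repeat split; auto.
      * eapply sbE_frame; eauto.
      * simpl; now rewrite ecomp_assoc.
Qed.

(* The second alternative is the one where the redex [y a] itself, together
   with the reset around it, is the pattern being replaced. *)
Lemma sb_eplug_inv rho E t u : sb rho (eplug E t) u ->
  (forall y F, rho y = RF F -> t <> fvar y) ->
  (exists E' t', sbE rho E E' /\ sb rho t t' /\ u = eplug E' t') \/
  (exists E1 E1' y F a a', t = app (fvar y) a /\ E = ecomp E1 (Ereset Ehole) /\
     rho y = RF F /\ sbE rho E1 E1' /\ sb rho a a' /\
     u = eplug E1' (reset (eplug F a'))).
Proof.
  intros H Ht; remember (eplug E t) as s eqn:e; revert E e.
  induction H; intros E e;
  (destruct E; simpl in e;
   [subst; left; exists Ehole; eexists; split; [constructor|];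
    split; [|simpl; reflexivity]; econstructor; eauto; fail | ..]); try discriminate;
    inversion e; subst.
  - destruct (IHsb2 _ eq_refl) as [(E' & s & HE & Ht' & ->) |
      (E1 & E1' & y & F & a & a' & -> & -> & Hy & HE & Ha & ->)].
    + left; eexists (EappR _ _), _; repeat split; eauto; constructor; eauto.
    + right; eexists (EappR _ _), (EappR _ _), _, _, _, _; repeat split; eauto;
      constructor; eauto.
  - destruct (IHsb1 _ eq_refl) as [(E' & s & HE & Ht' & ->) |
      (E1 & E1' & y & F & a & a' & -> & -> & Hy & HE & Ha & ->)].
    + left; eexists (EappL _ _), _; repeat split; eauto; constructor; eauto.
    + right; eexists (EappL _ _), (EappL _ _), _, _, _, _; repeat split; eauto;
      constructor; eauto.
  - destruct (IHsb _ eq_refl) as [(E' & s & HE & Ht' & ->) |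
      (E1 & E1' & y & F & a & a' & -> & -> & Hy & HE & Ha & ->)].
    + left; eexists (Ereset _), _; repeat split; eauto; constructor; eauto.
    + right; eexists (Ereset _), (Ereset _), _, _, _, _; repeat split; eauto;
      constructor; eauto.
  - destruct E; simpl in *; inversion H2; subst.
    + right; exists Ehole, Ehole; repeat eexists; eauto; constructor.
    + destruct (IHsb _ eq_refl) as [(E' & s & HE & Ht' & ->) |
        (E1 & E1' & y' & F' & a & a' & -> & -> & Hy & HE & Ha & ->)].
      * left; exists (Ereset (ecomp F E')), s; repeat split; eauto.
        -- eapply sbE_frame; eauto.
        -- simpl; now rewrite eplug_ecomp.
      * right; exists (Ereset (EappR (fvar y) E1)), (Ereset (ecomp F E1')), y', F', a, a'.
        repeat split; eauto.
        -- eapply sbE_frame; eauto.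
        -- simpl; now rewrite eplug_ecomp.
    + destruct E; simpl in *; try discriminate. exfalso; eapply Ht; eauto.
Qed.

Lemma sb_capture rho F F' : pure F -> sbE rho (Ereset F) (Ereset F') ->
  sb rho (capture F) (capture F').
Proof.
  intros HF H; constructor.
  change (sb rho (eplug (Ereset F) (bvar 0)) (eplug (Ereset F') (bvar 0))).
  apply sb_eplug; auto; constructor.
Qed.

(** Each step is matched by exactly one step. A redex of the source is never headed by a variable,
    and capture commutes with frame replacement because a captured [<y G>] just becomes [<F[G]>]. *)
Lemma sb_step rho t t' u : (forall y, repl_wf (rho y)) -> sb rho t u -> step t t' ->
  exists u', step u u' /\ sb rho t' u'.
Proof.
  intros Hwf H Hs; destruct Hs as [E t v HE Hv | E F t HE HF | E v HE Hv].
  - apply sb_eplug_inv in H; [|discriminate].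
    destruct H as [(E' & s & HE' & H & ->) | (? & ? & ? & ? & ? & ? & [=] & _)].
    inversion H as [| | |? ? ? ? H1 H2| | |]; subst; inversion H1; subst.
    eexists; split; [apply step_beta; eauto using sbE_ok, sb_value|].
    apply sb_eplug; auto. apply sb_open; auto.
  - apply sb_eplug_inv in H; [|discriminate].
    destruct H as [(E' & s & HE' & H & ->) | (? & ? & ? & ? & ? & ? & [=] & _)].
    change (reset (eplug F (shift t))) with (eplug (Ereset F) (shift t)) in H.
    apply sb_eplug_inv in H; [|discriminate].
    destruct H as [(F' & r & HF' & H & ->) | (? & ? & ? & ? & ? & ? & [=] & _)].
    inversion H; subst.
    destruct (sbE_reset_inv _ _ _ Hwf HF HF') as (F1 & HF1 & ->); simpl.
    eexists; split; [apply step_shift; eauto using sbE_ok|].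
    apply sb_eplug; auto. constructor. apply sb_open; auto. apply sb_capture; auto.
  - apply sb_eplug_inv in H; [|discriminate].
    destruct H as [(E' & s & HE' & H & ->) | (? & ? & ? & ? & ? & ? & [=] & _)].
    inversion H; subst; [|simpl in Hv; tauto].
    eexists; split; [apply step_reset; eauto using sbE_ok, sb_value|].
    apply sb_eplug; auto.
Qed.

Lemma sb_star rho t t' u : (forall y, repl_wf (rho y)) -> sb rho t u -> star t t' ->
  exists u', star u u' /\ sb rho t' u'.
Proof.
  intros Hwf H Hs; apply clos_rt_rt1n in Hs; revert u H.
  induction Hs as [|t s t' Hs _ IH]; intros u H.
  - exists u; split; [apply rt_refl | auto].
  - destruct (sb_step _ _ _ _ Hwf H Hs) as (u1 & H1 & H2).
    destruct (IH _ H2) as (u2 & H3 & H4).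
    exists u2; split; auto. eapply rt_trans; [apply rt_step|]; eauto.
Qed.

(** The source runs first, in lockstep with [u] by determinism. Redexes created by the substitution
    are met only once the source is irreducible, and the remaining [n - m] steps start there. *)
Lemma sb_nsteps_inv rho n t u r : (forall y, repl_wf (rho y)) -> sb rho t u ->
  nsteps n u r -> irreducible r ->
  exists m t' u', m <= n /\ nsteps m t t' /\ irreducible t' /\ sb rho t' u' /\
    nsteps (n - m) u' r.
Proof.
  intro Hwf; revert t u; induction n; intros t u H Hn Hr;
  (destruct (classic (exists t', step t t')) as [[t' Ht] | Ht];
   [| exists 0, t, u; rewrite Nat.sub_0_r; repeat split; auto with arith; constructor]);
  destruct (sb_step _ _ _ _ Hwf H Ht) as (u1 & H1 & H2).
  - inversion Hn; subst. exfalso; apply Hr; eauto.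
  - inversion Hn as [|? ? s ? Hs Hn']; subst.
    rewrite (step_det _ _ _ Hs H1) in Hn'.
    destruct (IHn _ _ H2 Hn' Hr) as (m & r' & u' & Hm & H3 & H4 & H5 & H6).
    exists (S m), r', u'; repeat split; auto; [lia|]; econstructor; eauto.
Qed.

(** * The closure of a simulation *)

Definition jrel (S : rel) (E0 E1 : ectx) : Prop :=
  forall x, ~ In x (fv_ctx E0 ++ fv_ctx E1) -> S (eplug E0 (fvar x)) (eplug E1 (fvar x)).

(** What the bisimulation test of [y] against [w] amounts to: [y z] is irreducible, so [w z] has to
    reach some [E[y a]]. Its context is compared with the empty one, which contains no reset, hence
    [E] is pure. Excluding a finite [L] leaves [z] free to be taken fresh for anything else. *)
Definition eta_step (S : rel) (X : nat -> term -> Prop) (y : nat) (w : term) : Prop :=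
  is_value w /\ lc w /\
  exists L, forall z, ~ In z L -> exists E a,
    star (app w (fvar z)) (eplug E (app (fvar y) a)) /\
    pure E /\ is_value a /\ jrel S Ehole E /\ X z a.

(* The existential [X] makes the variable case a greatest fixed point. In
   [vrel_lam] the right-hand side is [w z] and not [w @ z], because [cl] below
   is closed under expansion on the right. *)
Inductive vrel (S : rel) : term -> term -> Prop :=
| vrel_lam t w z : lc (lam t) -> is_value w -> lc w -> ~ In z (fv t ++ fv w) ->
    S (open t (fvar z)) (app w (fvar z)) -> vrel S (lam t) w
| vrel_fvar (X : nat -> term -> Prop) y w : X y w ->
    (forall y w, X y w -> eta_step S X y w) -> vrel S (fvar y) w.

(** [cl_ctx] demands pure contexts or delimited terms because relating [E0[x]] and [E1[x]] says
    nothing about the parts below their innermost resets, which a control stuck term would capture.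
    In [cl_sb] the condition on frames is written out so that the induction principle yields a
    hypothesis for it. The condition on values, nested in [vrel], yields none; there, applying a
    substituted abstraction lowers the step count instead. *)
Inductive cl (R : rel) : term -> term -> Prop :=
| cl_base t0 t1 : R t0 t1 -> lc t0 -> lc t1 -> cl R t0 t1
| cl_fvar x : cl R (fvar x) (fvar x)
| cl_app_fvar x y : cl R (app (fvar x) (fvar y)) (app (fvar x) (fvar y))
| cl_reset_fvar x : cl R (reset (fvar x)) (reset (fvar x))
| cl_lam x t0 t1 : cl R t0 t1 -> cl R (lam (close x t0)) (lam (close x t1))
| cl_shift x t0 t1 : cl R t0 t1 -> cl R (shift (close x t0)) (shift (close x t1))
| cl_reset_app k t0 t1 : cl R t0 t1 ->
    cl R (reset (app (fvar k) t0)) (reset (app (fvar k) t1))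
| cl_star t0 t1 t1' : cl R t0 t1' -> lc t1 -> star t1 t1' -> cl R t0 t1
| cl_ctx x E0 E1 t0 t1 : ectx_ok E0 -> ectx_ok E1 ->
    ~ In x (fv_ctx E0 ++ fv_ctx E1) ->
    cl R (eplug E0 (fvar x)) (eplug E1 (fvar x)) -> cl R t0 t1 ->
    (pure E0 /\ pure E1) \/ (delimited t0 /\ delimited t1) ->
    cl R (eplug E0 t0) (eplug E1 t1)
| cl_sb rho0 rho1 t0 t1 u0 u1 : cl R t0 t1 -> sb rho0 t0 u0 -> sb rho1 t1 u1 ->
    (forall y, repl_wf (rho0 y) /\ repl_wf (rho1 y)) ->
    (forall y F, rho0 y = RF F -> exists F', rho1 y = RF F') ->
    (forall y v, rho0 y = RV v -> exists v', rho1 y = RV v') ->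
    (forall y v0 v1, rho0 y = RV v0 -> rho1 y = RV v1 -> vrel (cl R) v0 v1) ->
    (forall y F0 F1, rho0 y = RF F0 -> rho1 y = RF F1 -> 
      forall x, ~ In x (fv_ctx F0 ++ fv_ctx F1) ->
        cl R (reset (eplug F0 (fvar x))) (reset (eplug F1 (fvar x)))) ->
    cl R u0 u1.

(** The premises of [cl_sb] in pointwise form; [cl_subst] and the last case of [cl_adequate] pass
    between the two. *)
Inductive rrel (S : rel) : repl -> repl -> Prop :=
| rrel_value v0 v1 : vrel S v0 v1 -> rrel S (RV v0) (RV v1)
| rrel_frame F0 F1 : pure F0 -> pure F1 -> lc_ctx F0 -> lc_ctx F1 ->
    jrel S (Ereset F0) (Ereset F1) -> rrel S (RF F0) (RF F1).

Ltac fresh_in := simpl in *; rewrite ?in_app_iff in *; simpl in *; tauto.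

Lemma vrel_fvar_inv S y w : vrel S (fvar y) w -> eta_step S (fun z a => vrel S (fvar z) a) y w.
Proof.
  intro H; inversion H as [|X ? ? HX Hstep]; subst.
  destruct (Hstep _ _ HX) as (H1 & H2 & L & HL).
  split; [|split]; auto. exists L; intros z Hz.
  destruct (HL z Hz) as (E & a & Hs & HE & Ha & Hj & HX').
  exists E, a; repeat split; auto. eapply vrel_fvar; eauto.
Qed.

Lemma vrel_wf S v0 v1 : vrel S v0 v1 -> (is_value v0 /\ lc v0) /\ is_value v1 /\ lc v1.
Proof.
  intro H; destruct v0; try (inversion H; fail).
  - destruct (vrel_fvar_inv _ _ _ H) as (H1 & H2 & _); repeat split; auto.
  - inversion H; subst; repeat split; auto.
Qed.

Lemma rrel_wf S r0 r1 : rrel S r0 r1 -> repl_wf r0 /\ repl_wf r1.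
Proof. destruct 1; simpl; [eapply vrel_wf; eauto | auto]. Qed.

Lemma rrel_upd S rho0 rho1 x r0 r1 : (forall y, rrel S (rho0 y) (rho1 y)) ->
  rrel S r0 r1 -> forall y, rrel S (upd rho0 x r0 y) (upd rho1 x r1 y).
Proof. intros H Hr y; unfold upd; destruct (Nat.eqb y x); auto. Qed.

Lemma cl_lc R t0 t1 : cl R t0 t1 -> lc t0 /\ lc t1.
Proof.
  induction 1; try (simpl; auto; fail).
  - repeat split.
  - repeat split.
  - repeat split.
  - destruct IHcl; split; apply lc_at_close; auto.
  - destruct IHcl; split; apply lc_at_close; auto.
  - destruct IHcl; repeat split; auto.
  - tauto.
  - rewrite !lc_eplug in *; tauto.
  - destruct IHcl; split; eapply sb_lc; eauto; apply H2.
Qed.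

Lemma cl_subst R rho0 rho1 t0 t1 u0 u1 : cl R t0 t1 ->
  (forall y, rrel (cl R) (rho0 y) (rho1 y)) ->
  sb rho0 t0 u0 -> sb rho1 t1 u1 -> cl R u0 u1.
Proof.
  intros Ht Hr H0 H1; apply cl_sb with rho0 rho1 t0 t1; auto.
  - intro y; eapply rrel_wf; eauto.
  - intros y F e; generalize (Hr y); rewrite e; inversion 1; eauto.
  - intros y F e; generalize (Hr y); rewrite e; inversion 1; eauto.
  - intros y v0 v1 e e'; generalize (Hr y); rewrite e, e'; inversion 1; auto.
  - intros y F0 F1 e e'; generalize (Hr y); rewrite e, e'; inversion 1; auto.
Qed.

Lemma vrel_fvar_refl R y : vrel (cl R) (fvar y) (fvar y).
Proof.
  apply vrel_fvar with (fun y w => w = fvar y); auto.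
  clear; intros y w ->. split; [exact I|]; split; [exact I|].
  exists []; intros z _; exists Ehole, (fvar z); repeat split; [apply rt_refl|].
  intros x _; apply cl_fvar.
Qed.

Lemma rrel_idr R y : rrel (cl R) (idr y) (idr y).
Proof. constructor; apply vrel_fvar_refl. Qed.

Lemma rrel_fvar R y : rrel (cl R) (RV (fvar y)) (RV (fvar y)).
Proof. apply rrel_idr. Qed.

Lemma cl_subst_ctx R x E0 E1 v0 v1 : cl R (eplug E0 (fvar x)) (eplug E1 (fvar x)) ->
  ~ In x (fv_ctx E0 ++ fv_ctx E1) -> vrel (cl R) v0 v1 ->
  cl R (eplug E0 v0) (eplug E1 v1).
Proof.
  intros H Hx Hv.
  apply (cl_subst R (upd idr x (RV v0)) (upd idr x (RV v1)) _ _ _ _ H).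
  - apply rrel_upd; [intro; apply rrel_idr | constructor; auto].
  - apply sb_subst; fresh_in.
  - apply sb_subst; fresh_in.
Qed.

(** Renaming is an instance of [cl_sb], so a single fresh variable serves for all. *)
Lemma jrel_intro R x E0 E1 : ~ In x (fv_ctx E0 ++ fv_ctx E1) ->
  cl R (eplug E0 (fvar x)) (eplug E1 (fvar x)) -> jrel (cl R) E0 E1.
Proof. intros Hx H y _; eapply cl_subst_ctx; eauto using vrel_fvar_refl. Qed.

Lemma jrel_value R E0 E1 v0 v1 : jrel (cl R) E0 E1 -> vrel (cl R) v0 v1 ->
  cl R (eplug E0 v0) (eplug E1 v1).
Proof.
  intros HE; destruct (fresh_exists (fv_ctx E0 ++ fv_ctx E1)) as [x Hx].
  eapply cl_subst_ctx; eauto.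
Qed.

Lemma jrel_plug R E0 E1 t0 t1 : jrel (cl R) E0 E1 -> ectx_ok E0 -> ectx_ok E1 ->
  cl R t0 t1 -> (pure E0 /\ pure E1) \/ (delimited t0 /\ delimited t1) ->
  cl R (eplug E0 t0) (eplug E1 t1).
Proof.
  intros HE; destruct (fresh_exists (fv_ctx E0 ++ fv_ctx E1)) as [x Hx].
  intros; eapply cl_ctx; eauto.
Qed.

Lemma jrel_lc R E0 E1 : jrel (cl R) E0 E1 -> lc_ctx E0 /\ lc_ctx E1.
Proof.
  intros HE; destruct (fresh_exists (fv_ctx E0 ++ fv_ctx E1)) as [x Hx].
  apply HE, cl_lc in Hx; rewrite !lc_eplug in Hx; tauto.
Qed.

Lemma jrel_sb R rho0 rho1 E0 E1 E0' E1' : jrel (cl R) E0 E1 ->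
  (forall y, rrel (cl R) (rho0 y) (rho1 y)) ->
  sbE rho0 E0 E0' -> sbE rho1 E1 E1' -> jrel (cl R) E0' E1'.
Proof.
  intros HE Hr H0 H1; destruct (fresh_exists (fv_ctx E0 ++ fv_ctx E1)) as [x Hx].
  intros y _.
  apply (cl_subst R (upd rho0 x (RV (fvar y))) (upd rho1 x (RV (fvar y))) _ _ _ _ (HE x Hx)).
  - apply rrel_upd; auto using rrel_fvar.
  - apply sb_eplug; auto using sb_upd_fvar. apply sbE_upd; auto; fresh_in.
  - apply sb_eplug; auto using sb_upd_fvar. apply sbE_upd; auto; fresh_in.
Qed.

Lemma jrel_hole R : jrel (cl R) Ehole Ehole.
Proof. intros x _; apply cl_fvar. Qed.

Lemma jrel_comp_pure R E0 E1 G0 G1 : jrel (cl R) E0 E1 -> jrel (cl R) G0 G1 ->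
  pure E0 -> pure E1 -> jrel (cl R) (ecomp E0 G0) (ecomp E1 G1).
Proof.
  intros HE HG P0 P1; destruct (fresh_exists (fv_ctx (ecomp E0 G0) ++ fv_ctx (ecomp E1 G1))) as [x Hx].
  apply jrel_intro with x; auto. rewrite !eplug_ecomp.
  apply jrel_plug; auto using pure_ok. apply HG.
  rewrite in_app_iff, !in_fv_ecomp in Hx; fresh_in.
Qed.

(** [cl_ctx] does not apply, since [<F0[]>] is not pure and [t0] may be control stuck. Instead, [k]
    in [<k t0>] and [<k t1>] is replaced by the frames [F0] and [F1]. *)
Lemma cl_reset_ctx R F0 F1 t0 t1 : jrel (cl R) (Ereset F0) (Ereset F1) ->
  pure F0 -> pure F1 -> cl R t0 t1 -> cl R (reset (eplug F0 t0)) (reset (eplug F1 t1)).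
Proof.
  intros HF P0 P1 Ht; destruct (fresh_exists (fv t0 ++ fv t1)) as [k Hk].
  destruct (jrel_lc _ _ _ HF) as [L0 L1].
  apply (cl_subst R (upd idr k (RF F0)) (upd idr k (RF F1)) _ _ _ _ (cl_reset_app R k _ _ Ht)).
  - apply rrel_upd; [intro; apply rrel_idr | constructor; auto].
  - eapply sb_frame; [apply upd_eq | apply sb_upd; [apply sb_idr | fresh_in]].
  - eapply sb_frame; [apply upd_eq | apply sb_upd; [apply sb_idr | fresh_in]].
Qed.

Lemma cl_reset R t0 t1 : cl R t0 t1 -> cl R (reset t0) (reset t1).
Proof.
  intros H; apply (cl_reset_ctx R Ehole Ehole); simpl; auto.
  intros x _; apply cl_reset_fvar.
Qed.

(** Built from [x y] by plugging first into [x []] and then into [[] u0] and [[] u1], all of them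
    pure contexts. *)
Lemma cl_app R t0 t1 u0 u1 : cl R t0 t1 -> cl R u0 u1 -> cl R (app t0 u0) (app t1 u1).
Proof.
  intros Ht Hu.
  destruct (fresh_exists (fv t0 ++ fv t1 ++ fv u0 ++ fv u1)) as [x Hx].
  destruct (fresh_exists [x]) as [y Hy].
  apply (cl_ctx R x (EappL Ehole u0) (EappL Ehole u1)); simpl; auto; [fresh_in|].
  apply (cl_ctx R y (EappR (fvar x) Ehole) (EappR (fvar x) Ehole)); simpl; auto; [fresh_in|].
  apply cl_app_fvar.
Qed.

Lemma sb_redex_inv rho E y a u : sb rho (eplug E (app (fvar y) a)) u ->
  (exists E' w a', rho y = RV w /\ sbE rho E E' /\ sb rho a a' /\
     u = eplug E' (app w a')) \/
  (exists E1 E1' F a', E = ecomp E1 (Ereset Ehole) /\ rho y = RF F /\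
     sbE rho E1 E1' /\ sb rho a a' /\ u = eplug E1' (reset (eplug F a'))).
Proof.
  intro H; apply sb_eplug_inv in H; [|discriminate].
  destruct H as [(E' & t' & HE & H & ->) |
    (E1 & E1' & z & F & b & a' & e & -> & Hz & HE & Ha & ->)].
  - inversion H as [| | |? ? w a' Hw Ha| | |]; subst.
    inversion Hw; subst. left; exists E', w, a'; auto.
  - inversion e; subst. right; exists E1, E1', F, a'; auto.
Qed.

Lemma sb_redex_value_inv rho E y a u w : sb rho (eplug E (app (fvar y) a)) u ->
  rho y = RV w ->
  exists E' a', sbE rho E E' /\ sb rho a a' /\ u = eplug E' (app w a').
Proof.
  intros H Hy; apply sb_redex_inv in H as
    [(E' & w' & a' & e & HE & Ha & ->) | (? & ? & F & ? & _ & e & _)];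
  rewrite Hy in e; inversion e; subst; eauto.
Qed.

(** The coinductive candidate is the set of all instances in which the expanded variable becomes the
    same variable on both sides. [vrel_fvar_comp] needs this case to transport the argument of an
    unfolded expansion. *)
Lemma vrel_rename R y0 y w w' rho0 rho1 : vrel (cl R) (fvar y0) w ->
  (forall x, rrel (cl R) (rho0 x) (rho1 x)) ->
  rho0 y0 = RV (fvar y) -> rho1 y0 = RV (fvar y) -> sb rho1 w w' ->
  vrel (cl R) (fvar y) w'.
Proof.
  intros Hw Hr e0 e1 Hs.
  apply vrel_fvar with (fun y w' => exists y0 w rho0 rho1,
    vrel (cl R) (fvar y0) w /\ (forall x, rrel (cl R) (rho0 x) (rho1 x)) /\
    rho0 y0 = RV (fvar y) /\ rho1 y0 = RV (fvar y) /\ sb rho1 w w');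
    [eauto 10|].
  clear; intros y w' (y0 & w & rho0 & rho1 & Hw & Hr & e0 & e1 & Hs).
  assert (Hwf : forall x, repl_wf (rho1 x)) by (intro; eapply rrel_wf; eauto).
  destruct (vrel_fvar_inv _ _ _ Hw) as (Hv & Hl & L & HL).
  split; [eapply sb_value; eauto|]; split; [eapply sb_lc; eauto|].
  exists []; intros z' _.
  (* Unfolding takes place at a fresh [z], which the extended substitutions then send to the given
     [z']; this is why the excluded list is empty. *)
  destruct (fresh_exists (y0 :: L ++ fv w)) as [z Hz].
  destruct (HL z) as (E & a & Hst & HE & Ha & Hj & Hza); [fresh_in|].
  set (r0 := upd rho0 z (RV (fvar z'))); set (r1 := upd rho1 z (RV (fvar z'))).
  assert (Hr' : forall x, rrel (cl R) (r0 x) (r1 x)) by (apply rrel_upd; auto using rrel_fvar).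
  assert (Hwf' : forall x, repl_wf (r1 x)) by (intro; eapply rrel_wf; eauto).
  assert (H0 : r0 y0 = RV (fvar y)) by (unfold r0; rewrite upd_neq; auto; intros ->; fresh_in).
  assert (H1 : r1 y0 = RV (fvar y)) by (unfold r1; rewrite upd_neq; auto; intros ->; fresh_in).
  destruct (fun h => sb_star r1 _ _ (app w' (fvar z')) Hwf' h Hst) as (u & Hu & Hsu).
  { constructor; [apply sb_upd; auto; fresh_in | apply sb_upd_fvar]. }
  destruct (sb_redex_value_inv _ _ _ _ _ _ Hsu H1) as (E' & a' & HE' & Ha' & ->).
  exists E', a'; split; auto; split; [eapply sbE_pure; eauto|].
  split; [eapply sb_value; eauto|]. split.
  - apply (jrel_sb R r0 r1 Ehole E); auto using sbE_hole.
  - exists z, a, r0, r1; repeat split; auto; apply upd_eq.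
Qed.

(* Composition of two eta-expansions: [w] expands [y0], for which [rho1]
   substitutes an expansion [b] of [y]. *)
Lemma vrel_fvar_comp R y0 y w w' b rho0 rho1 : vrel (cl R) (fvar y0) w ->
  (forall x, rrel (cl R) (rho0 x) (rho1 x)) ->
  rho1 y0 = RV b -> vrel (cl R) (fvar y) b -> sb rho1 w w' ->
  vrel (cl R) (fvar y) w'.
Proof.
  intros Hw Hr e1 Hb Hs.
  apply vrel_fvar with (fun y w' => exists y0 w b rho0 rho1,
    vrel (cl R) (fvar y0) w /\ (forall x, rrel (cl R) (rho0 x) (rho1 x)) /\
    rho1 y0 = RV b /\ vrel (cl R) (fvar y) b /\ sb rho1 w w');
    [eauto 12|].
  clear; intros y w' (y0 & w & b & rho0 & rho1 & Hw & Hr & e1 & Hb & Hs).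
  assert (Hwf : forall x, repl_wf (rho1 x)) by (intro; eapply rrel_wf; eauto).
  destruct (vrel_fvar_inv _ _ _ Hw) as (Hv & Hl & L & HL).
  destruct (vrel_fvar_inv _ _ _ Hb) as (Hvb & Hlb & Lb & HLb).
  split; [eapply sb_value; eauto|]; split; [eapply sb_lc; eauto|].
  exists []; intros z' _.
  destruct (fresh_exists (y0 :: L ++ fv w)) as [z Hz].
  destruct (HL z) as (E & a & Hst & HE & Ha & Hj & Hza); [fresh_in|].
  set (r0 := upd rho0 z (RV (fvar z'))); set (r1 := upd rho1 z (RV (fvar z'))).
  assert (Hr' : forall x, rrel (cl R) (r0 x) (r1 x)) by (apply rrel_upd; auto using rrel_fvar).
  assert (Hwf' : forall x, repl_wf (r1 x)) by (intro; eapply rrel_wf; eauto).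
  assert (H1 : r1 y0 = RV b) by (unfold r1; rewrite upd_neq; auto; intros ->; fresh_in).
  destruct (fun h => sb_star r1 _ _ (app w' (fvar z')) Hwf' h Hst) as (u & Hu & Hsu).
  { constructor; [apply sb_upd; auto; fresh_in | apply sb_upd_fvar]. }
  destruct (sb_redex_value_inv _ _ _ _ _ _ Hsu H1) as (E' & a' & HE' & Ha' & ->).
  assert (Hza' : vrel (cl R) (fvar z') a').
  { eapply vrel_rename with (rho0 := r0) (rho1 := r1); eauto; apply upd_eq. }
  (* The expansion [b] of [y] is unfolded at its own fresh [z2], which becomes [z'] on the left and
     [a'] on the right. The two unfoldings compose to [E'[G'[y c']]]. *)
  destruct (fresh_exists (y :: Lb ++ fv b)) as [z2 Hz2].
  destruct (HLb z2) as (G & c & Hst2 & HG & Hc & Hj2 & Hz2c); [fresh_in|].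
  set (q0 := upd idr z2 (RV (fvar z'))); set (q1 := upd idr z2 (RV a')).
  assert (Hq : forall x, rrel (cl R) (q0 x) (q1 x))
    by (apply rrel_upd; [intro; apply rrel_idr | constructor; auto]).
  assert (Hqf : forall x, repl_wf (q1 x)) by (intro; eapply rrel_wf; eauto).
  assert (Hqy : q1 y = RV (fvar y)) by (unfold q1; rewrite upd_neq; auto; intros ->; fresh_in).
  destruct (fun h => sb_star q1 _ _ (app b a') Hqf h Hst2) as (s & Hbs & Hss).
  { constructor; [apply sb_upd; [apply sb_idr | fresh_in] | apply sb_upd_fvar]. }
  destruct (sb_redex_value_inv _ _ _ _ _ _ Hss Hqy) as (G' & c' & HG' & Hc' & ->).
  assert (P1 : pure E') by (apply (sbE_pure r1 E); auto).
  assert (P2 : pure G') by (apply (sbE_pure q1 G); auto).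
  exists (ecomp E' G'), c'; split.
  { rewrite eplug_ecomp. eapply rt_trans; eauto. apply star_eplug; auto using pure_ok. }
  split; [apply pure_ecomp; auto|]. split; [apply (sb_value q1 c); auto|]. split.
  - change (jrel (cl R) (ecomp Ehole Ehole) (ecomp E' G')).
    apply jrel_comp_pure; auto; try exact I.
    + apply (jrel_sb R r0 r1 Ehole E); auto using sbE_hole.
    + apply (jrel_sb R q0 q1 Ehole G); auto using sbE_hole.
  - exists z2, c, a', q0, q1; repeat split; auto; apply upd_eq.
Qed.

(** The delicate case is a variable that becomes an abstraction. The pair then passes from the
    coinductive clause to [vrel_lam]: [u1 z'] reduces to [E'[b a']], and [cl_star] absorbs this
    reduction, however long it is. *)
Lemma vrel_sb R rho0 rho1 v0 v1 u0 u1 : vrel (cl R) v0 v1 ->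
  (forall x, rrel (cl R) (rho0 x) (rho1 x)) -> sb rho0 v0 u0 -> sb rho1 v1 u1 ->
  vrel (cl R) u0 u1.
Proof.
  intros Hv Hr H0 H1.
  assert (Hwf0 : forall x, repl_wf (rho0 x)) by (intro x; apply (rrel_wf _ _ _ (Hr x))).
  assert (Hwf1 : forall x, repl_wf (rho1 x)) by (intro x; apply (rrel_wf _ _ _ (Hr x))).
  destruct (vrel_wf _ _ _ Hv) as [[V0 L0] [V1 L1]].
  assert (V1' : is_value u1) by (apply (sb_value rho1 v1); auto).
  assert (L1' : lc u1) by (exact (sb_lc rho1 v1 u1 Hwf1 H1 0 L1)).
  inversion Hv as [t w z Ht _ _ Hz Hc | X y w HX Hstep]; subst.
  - inversion H0 as [| |? u Hu| | | |]; subst.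
    destruct (fresh_exists (fv u ++ fv u1)) as [z' Hz'].
    apply vrel_lam with z'; auto; [eapply (sb_lc rho0 (lam t)); eauto|].
    apply (cl_subst R (upd rho0 z (RV (fvar z'))) (upd rho1 z (RV (fvar z'))) _ _ _ _ Hc).
    + apply rrel_upd; auto using rrel_fvar.
    + apply sb_open_upd; simpl; auto; fresh_in.
    + constructor; [apply sb_upd; auto; fresh_in | apply sb_upd_fvar].
  - inversion H0 as [? ? e| | | | | |]; subst.
    assert (Hb : exists b, rho1 y = RV b /\ vrel (cl R) u0 b).
    { generalize (Hr y); rewrite e; inversion 1; subst; eauto. }
    destruct Hb as (b & e1 & Hb).
    destruct (vrel_wf _ _ _ Hb) as [[V0' L0'] [Vb Lb]].
    destruct u0 as [y'| |t| | |]; try (simpl in V0'; tauto).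
    + apply (vrel_fvar_comp R y y' v1 u1 b rho0 rho1); auto.
    + inversion Hb as [? ? z _ _ _ Hz Hc|]; subst.
      destruct (vrel_fvar_inv _ _ _ Hv) as (_ & _ & L & HL).
      destruct (fresh_exists (fv t ++ fv u1)) as [z' Hz'].
      apply vrel_lam with z'; auto.
      destruct (fresh_exists (y :: L ++ fv v1)) as [z2 Hz2].
      destruct (HL z2) as (E & a & Hst & HE & Ha & Hj & Hza); [fresh_in|].
      set (r0 := upd rho0 z2 (RV (fvar z'))); set (r1 := upd rho1 z2 (RV (fvar z'))).
      assert (Hr' : forall x, rrel (cl R) (r0 x) (r1 x)) by (apply rrel_upd; auto using rrel_fvar).
      assert (Hwf' : forall x, repl_wf (r1 x)) by (intro; eapply rrel_wf; eauto).
      assert (Hy : r1 y = RV b) by (unfold r1; rewrite upd_neq; auto; intros ->; fresh_in).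
      destruct (fun h => sb_star r1 _ _ (app u1 (fvar z')) Hwf' h Hst) as (u & Hu & Hsu).
      { constructor; [apply sb_upd; auto; fresh_in | apply sb_upd_fvar]. }
      destruct (sb_redex_value_inv _ _ _ _ _ _ Hsu Hy) as (E' & a' & HE' & Ha' & ->).
      assert (Hza' : vrel (cl R) (fvar z') a').
      { eapply vrel_rename with (rho0 := r0) (rho1 := r1); eauto; apply upd_eq. }
      assert (PE : pure E') by (apply (sbE_pure r1 E); auto).
      apply cl_star with (eplug E' (app b a')); auto; [|split; auto; exact I].
      apply (jrel_plug R Ehole E'); auto using pure_ok; try exact I.
      * apply (jrel_sb R r0 r1 Ehole E); auto using sbE_hole.
      * apply (cl_subst R (upd idr z (RV (fvar z'))) (upd idr z (RV a')) _ _ _ _ Hc).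
        -- apply rrel_upd; [intro; apply rrel_idr | constructor; auto].
        -- apply sb_open_upd; simpl; auto using idr_wf, sb_idr; fresh_in.
        -- constructor; [apply sb_upd; [apply sb_idr | fresh_in] | apply sb_upd_fvar].
Qed.

(** * Adequacy *)

(** Splitting at the innermost reset lets any related terms be plugged in: once below [<F0>] and
    [<F1>] they are delimited, and the outer contexts may then contain resets. *)
Definition krel (S : rel) (E0 E1 : ectx) : Prop :=
  (exists A0 F0 A1 F1, E0 = ecomp A0 (Ereset F0) /\ E1 = ecomp A1 (Ereset F1) /\
     pure F0 /\ pure F1 /\ jrel S A0 A1 /\ jrel S (Ereset F0) (Ereset F1)) \/
  (pure E0 /\ pure E1 /\ jrel S E0 E1).

(** The counterpart of [rnf] for the closure. One fresh [k] is enough because [cl] is closed under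
    renaming. *)
Inductive nf (S : rel) : term -> term -> Prop :=
| nf_value v0 v1 : vrel S v0 v1 -> nf S v0 v1
| nf_open E0 E1 x v0 v1 : ectx_ok E0 -> ectx_ok E1 -> krel S E0 E1 -> vrel S v0 v1 ->
    nf S (eplug E0 (app (fvar x) v0)) (eplug E1 (app (fvar x) v1))
| nf_ctrl F0 F1 t0 t1 k : pure F0 -> pure F1 ->
    ~ In k (fv_ctx F0 ++ fv t0 ++ fv_ctx F1 ++ fv t1) ->
    S (reset (open t0 (capture (EappR (fvar k) F0))))
      (reset (open t1 (capture (EappR (fvar k) F1)))) ->
    nf S (eplug F0 (shift t0)) (eplug F1 (shift t1)).

(** The bound counts the steps of the left-hand term only, since the right-hand one may spend any
    number of steps on unfolding eta-expansions. *)
Definition adequate (R : rel) (n : nat) (t0 t1 : term) : Prop :=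
  forall m r0, m <= n -> nsteps m t0 r0 -> irreducible r0 ->
    exists r1, eval t1 r1 /\ nf (cl R) r0 r1.

Lemma krel_plug R E0 E1 t0 t1 : krel (cl R) E0 E1 -> ectx_ok E0 -> ectx_ok E1 ->
  cl R t0 t1 -> cl R (eplug E0 t0) (eplug E1 t1).
Proof.
  intros [(A0 & F0 & A1 & F1 & -> & -> & P0 & P1 & HA & HF) | (P0 & P1 & HE)] O0 O1 Ht.
  - apply ectx_ok_ecomp in O0 as [O0 _], O1 as [O1 _].
    rewrite !eplug_ecomp; simpl.
    apply jrel_plug; auto using cl_reset_ctx. right; split; exact I.
  - apply jrel_plug; auto.
Qed.

Lemma krel_sb R rho0 rho1 E0 E1 E0' E1' : krel (cl R) E0 E1 ->
  (forall y, rrel (cl R) (rho0 y) (rho1 y)) ->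
  sbE rho0 E0 E0' -> sbE rho1 E1 E1' -> krel (cl R) E0' E1'.
Proof.
  intros HE Hr H0 H1.
  assert (Hwf0 : forall x, repl_wf (rho0 x)) by (intro x; apply (rrel_wf _ _ _ (Hr x))).
  assert (Hwf1 : forall x, repl_wf (rho1 x)) by (intro x; apply (rrel_wf _ _ _ (Hr x))).
  destruct HE as [(A0 & F0 & A1 & F1 & -> & -> & P0 & P1 & HA & HF) | (P0 & P1 & HE)].
  - apply sbE_ecomp_reset_inv in H0 as (A0' & B0 & HA0 & HB0 & ->).
    apply sbE_ecomp_reset_inv in H1 as (A1' & B1 & HA1 & HB1 & ->).
    destruct (sbE_reset_inv _ _ _ Hwf0 P0 HB0) as (G0 & PG0 & ->).
    destruct (sbE_reset_inv _ _ _ Hwf1 P1 HB1) as (G1 & PG1 & ->).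
    left; exists A0', G0, A1', G1; repeat split; auto.
    + apply (jrel_sb R rho0 rho1 A0 A1); auto.
    + apply (jrel_sb R rho0 rho1 (Ereset F0) (Ereset F1)); auto.
  - right; repeat split; [apply (sbE_pure rho0 E0) | apply (sbE_pure rho1 E1) |
      apply (jrel_sb R rho0 rho1 E0 E1)]; auto.
Qed.

(** When the outer contexts are not pure, the delimited terms force a reset at the top of [E0] and
    [E1]. This rules out the pure alternative and allows [B0] and [B1] to be plugged below [A0] and
    [A1]. *)
Lemma krel_comp_outer R A0 A1 E0 E1 x v0 v1 :
  jrel (cl R) A0 A1 -> ectx_ok A0 -> ectx_ok A1 -> krel (cl R) E0 E1 ->
  (pure A0 /\ pure A1) \/ (delimited (eplug E0 (app (fvar x) v0)) /\
                           delimited (eplug E1 (app (fvar x) v1))) ->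
  krel (cl R) (ecomp A0 E0) (ecomp A1 E1).
Proof.
  intros HA O0 O1 [(B0 & F0 & B1 & F1 & -> & -> & P0 & P1 & HB & HF) | (P0 & P1 & HE)] Hm.
  - left; exists (ecomp A0 B0), F0, (ecomp A1 B1), F1.
    rewrite !ecomp_assoc; repeat split; auto.
    destruct (fresh_exists (fv_ctx (ecomp A0 B0) ++ fv_ctx (ecomp A1 B1))) as [y Hy].
    apply jrel_intro with y; auto.
    rewrite !eplug_ecomp; apply jrel_plug; auto.
    + apply HB. rewrite in_app_iff, !in_fv_ecomp in Hy; fresh_in.
    + destruct Hm as [Hm | [D0 D1]]; [auto | right].
      destruct B0, B1; simpl in *; auto.
  - destruct Hm as [[Q0 Q1] | [D0 D1]].
    + right; repeat split; [apply pure_ecomp | apply pure_ecomp |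
        apply jrel_comp_pure]; auto.
    + destruct E0; simpl in *; tauto.
Qed.

Lemma krel_comp_inner R E0 E1 G0 G1 : krel (cl R) E0 E1 -> jrel (cl R) G0 G1 ->
  pure G0 -> pure G1 -> krel (cl R) (ecomp E0 G0) (ecomp E1 G1).
Proof.
  intros [(B0 & F0 & B1 & F1 & -> & -> & P0 & P1 & HB & HF) | (P0 & P1 & HE)] HG Q0 Q1.
  - left; exists B0, (ecomp F0 G0), B1, (ecomp F1 G1).
    rewrite !ecomp_assoc, !pure_ecomp; repeat split; auto.
    destruct (fresh_exists (fv_ctx (ecomp F0 G0) ++ fv_ctx (ecomp F1 G1))) as [y Hy].
    apply jrel_intro with y; auto. simpl; rewrite !eplug_ecomp.
    apply cl_reset_ctx; auto. apply HG.
    rewrite in_app_iff, !in_fv_ecomp in Hy; fresh_in.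
  - right; rewrite !pure_ecomp; repeat split; auto using jrel_comp_pure.
Qed.

Lemma krel_reset_app R k E0 E1 : krel (cl R) E0 E1 ->
  krel (cl R) (Ereset (EappR (fvar k) E0)) (Ereset (EappR (fvar k) E1)).
Proof.
  assert (Hj : forall E0 E1, jrel (cl R) E0 E1 ->
    jrel (cl R) (Ereset (EappR (fvar k) E0)) (Ereset (EappR (fvar k) E1))).
  { intros A0 A1 HA. 
    destruct (fresh_exists (k :: fv_ctx A0 ++ fv_ctx A1)) as [y Hy].
    apply jrel_intro with y; [fresh_in|].
    simpl; apply cl_reset_app, HA; fresh_in. }
  intros [(B0 & F0 & B1 & F1 & -> & -> & P0 & P1 & HB & HF) | (P0 & P1 & HE)]; left.
  - exists (Ereset (EappR (fvar k) B0)), F0, (Ereset (EappR (fvar k) B1)), F1.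
    repeat split; auto.
  - exists Ehole, (EappR (fvar k) E0), Ehole, (EappR (fvar k) E1).
    repeat split; auto using jrel_hole.
Qed.

Lemma reset_hole_inj A B F : pure F -> ecomp A (Ereset Ehole) = ecomp B (Ereset F) ->
  A = B /\ F = Ehole.
Proof.
  intro HF; revert B; induction A; intros B e; destruct B; simpl in *;
    inversion e; subst; auto;
    try (edestruct IHA as [-> ->]; eauto; fail); try (destruct A; discriminate);
    try (destruct B; discriminate).
  simpl in HF. exfalso; clear -HF. induction A; simpl in *; tauto.
Qed.

(** Used when the hole of [<[]>] held a replaced [y a]. The innermost reset is the one around the
    hole, so the split can only occur there. *)
Lemma krel_reset_hole R A0 A1 : krel (cl R) (ecomp A0 (Ereset Ehole)) (ecomp A1 (Ereset Ehole)) ->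
  jrel (cl R) A0 A1.
Proof.
  intros [(B0 & F0 & B1 & F1 & e0 & e1 & P0 & P1 & HB & HF) | (P0 & P1 & HE)].
  - apply reset_hole_inj in e0 as [-> _], e1 as [-> _]; auto.
  - apply pure_ecomp in P0 as [_ []].
Qed.

(* The captured context [F[G]] is obtained from [k' G] by the frame replacement
   of [k'] by [k F]. *)
Lemma cl_ctrl_comp R F0 F1 G0 G1 t0 t1 k k' :
  jrel (cl R) F0 F1 -> pure F0 -> pure F1 -> 
  ~ In k' (fv_ctx G0 ++ fv t0 ++ fv_ctx G1 ++ fv t1) ->
  cl R (reset (open t0 (capture (EappR (fvar k') G0))))
       (reset (open t1 (capture (EappR (fvar k') G1)))) ->
  cl R (reset (open t0 (capture (EappR (fvar k) (ecomp F0 G0)))))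
       (reset (open t1 (capture (EappR (fvar k) (ecomp F1 G1))))).
Proof.
  intros HF P0 P1 Hk Hc. destruct (jrel_lc _ _ _ HF) as [L0 L1].
  assert (Hr : forall y, rrel (cl R) (upd idr k' (RF (EappR (fvar k) F0)) y)
                                     (upd idr k' (RF (EappR (fvar k) F1)) y)).
  { apply rrel_upd; [intro; apply rrel_idr|].
    constructor; try (repeat split; auto; exact I).
    destruct (fresh_exists (k :: fv_ctx F0 ++ fv_ctx F1)) as [y Hy].
    apply jrel_intro with y; [fresh_in|].
    simpl; apply cl_reset_app, HF; fresh_in. }
  apply (cl_subst R _ _ _ _ _ _ Hc Hr).
  - constructor. apply sb_open; [intro y; apply (rrel_wf _ _ _ (Hr y)) | |
      apply sb_upd; [apply sb_idr | fresh_in]].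
    constructor; simpl. rewrite eplug_ecomp.
    apply (sb_frame _ k' (EappR (fvar k) F0)); [apply upd_eq|].
    apply sb_eplug; [apply sbE_upd; [apply sbE_idr | fresh_in] | constructor].
  - constructor. apply sb_open; [intro y; apply (rrel_wf _ _ _ (Hr y)) | |
      apply sb_upd; [apply sb_idr | fresh_in]].
    constructor; simpl. rewrite eplug_ecomp.
    apply (sb_frame _ k' (EappR (fvar k) F1)); [apply upd_eq|].
    apply sb_eplug; [apply sbE_upd; [apply sbE_idr | fresh_in] | constructor].
Qed.

Lemma nf_ctrl_any R F0 F1 t0 t1 k k' : 
  ~ In k' (fv_ctx F0 ++ fv t0 ++ fv_ctx F1 ++ fv t1) ->
  cl R (reset (open t0 (capture (EappR (fvar k') F0))))
       (reset (open t1 (capture (EappR (fvar k') F1)))) ->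
  cl R (reset (open t0 (capture (EappR (fvar k) F0))))
       (reset (open t1 (capture (EappR (fvar k) F1)))).
Proof. apply (cl_ctrl_comp R Ehole Ehole); try exact I; apply jrel_hole. Qed.

Lemma adequate_mono R m n t0 t1 : m <= n -> adequate R n t0 t1 -> adequate R m t0 t1.
Proof. intros Hm H j r0 Hj; apply H; lia. Qed.

Lemma adequate_irreducible R n t0 t1 r1 : irreducible t0 -> eval t1 r1 ->
  nf (cl R) t0 r1 -> adequate R n t0 t1.
Proof.
  intros Hi He Hn m r0 _ Hs _.
  apply nsteps_irreducible in Hs as [_ ->]; eauto.
Qed.

(** The term in the hole runs to its normal form first. Open stuck terms compose their contexts;
    control stuck terms compose with pure contexts and cannot arise from delimited terms. Only a
    returned value lets the run go on, and that case is left to the last hypothesis. *)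
Lemma adequate_plug R n E0 E1 t0 t1 :
  jrel (cl R) E0 E1 -> ectx_ok E0 -> ectx_ok E1 ->
  (pure E0 /\ pure E1) \/ (delimited t0 /\ delimited t1) ->
  adequate R n t0 t1 ->
  (forall m v0 v1, m <= n -> nsteps m t0 v0 -> vrel (cl R) v0 v1 ->
     adequate R (n - m) (eplug E0 v0) (eplug E1 v1)) ->
  adequate R n (eplug E0 t0) (eplug E1 t1).
Proof.
  intros HE O0 O1 Hm Ht Hv m r0 Hmn Hs Hr.
  apply nsteps_eplug_inv in Hs as (j & r' & Hj & Hs & Hr' & Hs'); auto.
  destruct (Ht j r') as (r1 & [He Hi] & Hn); auto; [lia|].
  assert (Hst : star (eplug E1 t1) (eplug E1 r1)) by auto using star_eplug.
  destruct Hn as [v0 v1 Hvv | G0 G1 x v0 v1 OG0 OG1 HG Hvv | F0 F1 s0 s1 k P0 P1 Hk Hc].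
  - destruct (Hv j v0 v1) with (m := m - j) (r0 := r0) as (r2 & He2 & Hn2); auto; try lia.
    exists r2; split; auto. eapply eval_star; eauto.
  - destruct (vrel_wf _ _ _ Hvv) as [[V0 _] [V1 _]].
    assert (O0' : ectx_ok (ecomp E0 G0)) by (apply ectx_ok_ecomp; auto).
    assert (O1' : ectx_ok (ecomp E1 G1)) by (apply ectx_ok_ecomp; auto).
    rewrite <- eplug_ecomp in Hs', Hst.
    apply nsteps_irreducible in Hs' as [_ ->]; [|apply irreducible_open; auto].
    eexists; split; [split; [exact Hst | apply irreducible_open; auto]|].
    apply nf_open; auto.
    apply krel_comp_outer with x v0 v1; auto.
    destruct Hm as [Hm | [D0 D1]]; [auto | right].
    split; [eapply delimited_star; [|exact D0]; eapply nsteps_star; eauto |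
            eapply delimited_star; eauto].
  - destruct Hm as [[Q0 Q1] | [D0 _]].
    + assert (P0' : pure (ecomp E0 F0)) by (apply pure_ecomp; auto).
      assert (P1' : pure (ecomp E1 F1)) by (apply pure_ecomp; auto).
      rewrite <- eplug_ecomp in Hs', Hst.
      apply nsteps_irreducible in Hs' as [_ ->]; [|apply irreducible_ctrl; auto].
      eexists; split; [split; [exact Hst | apply irreducible_ctrl; auto]|].
      destruct (fresh_exists (fv_ctx (ecomp E0 F0) ++ fv s0 ++ fv_ctx (ecomp E1 F1) ++ fv s1))
        as [k' Hk'].
      apply nf_ctrl with k'; auto.
      apply cl_ctrl_comp with k; auto.
    + exfalso. apply nsteps_star in Hs. apply (delimited_star _ _ Hs) in D0.
      destruct F0; simpl in *; tauto.
Qed.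

(** The run of [u0] starts with a run of [t0] to a normal form. Values and control stuck terms stay
    normal under substitution; for [E0[y a0]] the replacement of [y] decides. A variable stays
    stuck, an abstraction triggers a beta step, and a frame turns [<y a0>] into [<F0[b0]>], covered
    by the third hypothesis. *)
Lemma adequate_sb R n rho0 rho1 t0 t1 u0 u1 :
  (forall m, m < n -> forall a b, cl R a b -> adequate R m a b) ->
  (forall y, rrel (cl R) (rho0 y) (rho1 y)) ->
  (forall y F0 F1 a0 a1, rho0 y = RF F0 -> rho1 y = RF F1 -> vrel (cl R) a0 a1 ->
     adequate R n (reset (eplug F0 a0)) (reset (eplug F1 a1))) ->
  adequate R n t0 t1 -> sb rho0 t0 u0 -> sb rho1 t1 u1 -> adequate R n u0 u1.
Proof.
  intros IH Hr HF Ht H0 H1 m r0 Hmn Hs Hir.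
  assert (Hwf0 : forall x, repl_wf (rho0 x)) by (intro x; apply (rrel_wf _ _ _ (Hr x))).
  assert (Hwf1 : forall x, repl_wf (rho1 x)) by (intro x; apply (rrel_wf _ _ _ (Hr x))).
  destruct (sb_nsteps_inv _ _ _ _ _ Hwf0 H0 Hs Hir) as (j & t0' & u0' & Hj & Hst & Hi & Hs0 & Hs').
  destruct (Ht j t0') as (t1' & [He1 Hi1] & Hn); auto; [lia|].
  destruct (sb_star _ _ _ _ Hwf1 H1 He1) as (u1' & Hu1 & Hs1).
  enough (Hen : exists r1, eval u1' r1 /\ nf (cl R) r0 r1).
  { destruct Hen as (r1 & He & Hnf); exists r1; split; auto; eapply eval_star; eauto. }
  clear H0 H1 Hs Hst He1 Hu1 Ht Hi Hi1 t0 t1 u0 u1.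
  destruct Hn as [v0 v1 Hvv | E0 E1 y a0 a1 O0 O1 HE Ha | F0 F1 s0 s1 k P0 P1 Hk Hc].
  - assert (Hv : vrel (cl R) u0' u1') by eauto using vrel_sb.
    destruct (vrel_wf _ _ _ Hv) as [[V0 _] [V1 _]].
    apply nsteps_irreducible in Hs' as [_ ->]; auto using irreducible_value.
    exists u1'; split; [apply eval_refl; auto using irreducible_value | apply nf_value; auto].
  - apply sb_redex_inv in Hs0 as [(E0' & w0 & b0 & e0 & HE0 & Hb0 & ->) |
      (A0 & A0' & F0 & b0 & -> & e0 & HA0 & Hb0 & ->)];
    apply sb_redex_inv in Hs1 as [(E1' & w1 & b1 & e1 & HE1 & Hb1 & ->) |
      (A1 & A1' & F1 & b1 & -> & e1 & HA1 & Hb1 & ->)];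
    generalize (Hr y); rewrite e0, e1; inversion 1 as [? ? Hw | ? ? P0 P1 L0 L1 HJ]; subst.
    + assert (Hb : vrel (cl R) b0 b1) by eauto using vrel_sb.
      assert (HK : krel (cl R) E0' E1') by (apply (krel_sb R rho0 rho1 E0 E1); auto).
      assert (O0' : ectx_ok E0') by (apply (sbE_ok rho0 E0); auto).
      assert (O1' : ectx_ok E1') by (apply (sbE_ok rho1 E1); auto).
      destruct (vrel_wf _ _ _ Hb) as [[V0 LV0] [V1 LV1]].
      destruct (vrel_wf _ _ _ Hw) as [[W0 LW0] [W1 LW1]].
      destruct w0 as [x| |t| | |]; try (simpl in W0; tauto).
      (* The left-hand term is stuck, while [w1] may be any eta-expansion of [x]: it is unfolded
         once, with [b0] and [b1] put for the fresh [z]. *)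
      * apply nsteps_irreducible in Hs' as [_ ->]; [|apply irreducible_open; auto].
        destruct (vrel_fvar_inv _ _ _ Hw) as (_ & _ & L & HL).
        destruct (fresh_exists (x :: L ++ fv w1)) as [z Hz].
        destruct (HL z) as (G & c & Hsg & HG & Vc & HJ & Hzc); [fresh_in|].
        set (q0 := upd idr z (RV b0)); set (q1 := upd idr z (RV b1)).
        assert (Hq : forall x, rrel (cl R) (q0 x) (q1 x))
          by (apply rrel_upd; [intro; apply rrel_idr | apply rrel_value; auto]).
        assert (Hqf : forall x, repl_wf (q1 x)) by (intro y'; apply (rrel_wf _ _ _ (Hq y'))).
        assert (Hqx : q1 x = RV (fvar x)) by (unfold q1; rewrite upd_neq; auto; intros ->; fresh_in).
        destruct (fun h => sb_star q1 _ _ (app w1 b1) Hqf h Hsg) as (s & Hws & Hss).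
        { constructor; [apply sb_upd; [apply sb_idr | fresh_in] | apply sb_upd_fvar]. }
        destruct (sb_redex_value_inv _ _ _ _ _ _ Hss Hqx) as (G' & c' & HG' & Hc' & ->).
        assert (PG : pure G') by (apply (sbE_pure q1 G); auto).
        assert (Vc' : is_value c') by (apply (sb_value q1 c); auto).
        assert (OG : ectx_ok (ecomp E1' G')) by (apply ectx_ok_ecomp; auto using pure_ok).
        exists (eplug (ecomp E1' G') (app (fvar x) c')); split.
        -- split; [|apply irreducible_open; auto].
           rewrite eplug_ecomp; apply star_eplug; auto.
        -- apply nf_open; auto.
           ++ rewrite <- (ecomp_hole E0'). apply krel_comp_inner; auto; try exact I.
              apply (jrel_sb R q0 q1 Ehole G); auto using sbE_hole.
           ++ apply (vrel_sb R q0 q1 (fvar z) c); auto; apply sb_upd_fvar.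
      (* [r0] is irreducible, so at least the beta step is taken and the induction hypothesis
         applies at [n - 1]. *)
      * assert (Hbeta := step_eplug E0' _ _ O0' (step_beta_top t b0 V0)).
        inversion Hs' as [? e1' e2' e3' | n' ? s ? Hs1 Hs2 e1' e2' e3']; subst.
        { exfalso; apply Hir; eauto. }
        rewrite (step_det _ _ _ Hs1 Hbeta) in Hs2.
        refine (IH (n - 1) _ _ _ _ n' r0 _ Hs2 Hir); try lia.
        inversion Hw as [? ? z _ _ _ Hz Hc |]; subst.
        apply krel_plug; auto.
        apply (cl_subst R (upd idr z (RV b0)) (upd idr z (RV b1)) _ _ _ _ Hc).
        -- apply rrel_upd; [intro; apply rrel_idr | constructor; auto].
        -- apply sb_open_upd; auto using idr_wf, sb_idr; fresh_in.
        -- constructor; [apply sb_upd; [apply sb_idr | fresh_in] | apply sb_upd_fvar].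
    + assert (Hb : vrel (cl R) b0 b1) by eauto using vrel_sb.
      assert (HJA : jrel (cl R) A0' A1').
      { apply krel_reset_hole in HE. apply (jrel_sb R rho0 rho1 A0 A1); auto. }
      apply ectx_ok_ecomp in O0 as [O0 _], O1 as [O1 _].
      refine (adequate_plug R n A0' A1' (reset (eplug F0 b0)) (reset (eplug F1 b1))
        HJA _ _ _ _ _ (m - j) r0 _ Hs' Hir); try lia.
      * apply (sbE_ok rho0 A0); auto.
      * apply (sbE_ok rho1 A1); auto.
      * right; split; exact I.
      * eapply HF; eauto.
      (* A term headed by a reset needs at least one step to return a value, so the outer contexts
         resume under a smaller bound. *)
      * intros i v0 v1 Hi Hsi Hv. destruct i.
        { inversion Hsi; subst. destruct (vrel_wf _ _ _ Hv) as [[[] _] _]. }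
        apply IH; [lia|]. apply jrel_value; auto.
  - apply sb_eplug_inv in Hs0; [|discriminate]. apply sb_eplug_inv in Hs1; [|discriminate].
    destruct Hs0 as [(F0' & t0' & HF0 & Hs0 & ->) | (? & ? & ? & ? & ? & ? & [=] & _)].
    destruct Hs1 as [(F1' & t1' & HF1 & Hs1 & ->) | (? & ? & ? & ? & ? & ? & [=] & _)].
    inversion Hs0 as [| | | |? s0' Hs0'| |]; subst.
    inversion Hs1 as [| | | |? s1' Hs1'| |]; subst.
    assert (P0' : pure F0') by (apply (sbE_pure rho0 F0); auto).
    assert (P1' : pure F1') by (apply (sbE_pure rho1 F1); auto).
    apply nsteps_irreducible in Hs' as [_ ->]; [|apply irreducible_ctrl; auto].
    eexists; split; [apply eval_refl, irreducible_ctrl; auto|].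
    destruct (fresh_exists (fv_ctx F0' ++ fv s0' ++ fv_ctx F1' ++ fv s1')) as [k' Hk'].
    apply nf_ctrl with k'; auto.
    assert (Hr' : forall x, rrel (cl R) (upd rho0 k (RV (fvar k')) x) (upd rho1 k (RV (fvar k')) x))
      by (apply rrel_upd; auto using rrel_fvar).
    apply (cl_subst R _ _ _ _ _ _ Hc Hr').
    + constructor. apply sb_open; [intro y; apply (rrel_wf _ _ _ (Hr' y)) | |
        apply sb_upd; auto; fresh_in].
      repeat constructor; simpl; [apply upd_eq|].
      apply sb_eplug; [apply sbE_upd; auto; fresh_in | constructor].
    + constructor. apply sb_open; [intro y; apply (rrel_wf _ _ _ (Hr' y)) | |
        apply sb_upd; auto; fresh_in].
      repeat constructor; simpl; [apply upd_eq|].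
      apply sb_eplug; [apply sbE_upd; auto; fresh_in | constructor].
Qed.

(** * From the normal form tests of a simulation to the closure *)

Lemma star_vapp v y : is_value v -> star (app v (fvar y)) (vapp v y).
Proof.
  destruct v; simpl; try tauto; intros _; [apply rt_refl|].
  apply rt_step, step_beta_top; exact I.
Qed.

Lemma ctx_rel_krel R E0 E1 : lc_ctx E0 -> lc_ctx E1 -> ctx_rel R E0 E1 -> krel (cl R) E0 E1.
Proof.
  intros L0 L1; destruct (fresh_exists (fv_ctx E0 ++ fv_ctx E1)) as [x Hx].
  intros [(A0 & F0 & A1 & F1 & _ & P0 & _ & P1 & -> & -> & H) | (P0 & P1 & H)].
  - destruct (H x Hx) as [HA HF].
    apply lc_ctx_ecomp in L0 as [LA0 LF0], L1 as [LA1 LF1].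
    rewrite in_app_iff, !in_fv_ecomp in Hx.
    left; exists A0, F0, A1, F1; repeat split; auto; apply jrel_intro with x;
      try fresh_in; apply cl_base; auto; apply lc_eplug; split; auto; exact I.
  - right; repeat split; auto. apply jrel_intro with x; auto.
    apply cl_base; auto; apply lc_eplug; split; auto; exact I.
Qed.

Lemma rnf_value_inv R v0 v1 : rnf R v0 v1 -> is_value v0 ->
  is_value v1 /\ forall x, ~ In x (fv v0 ++ fv v1) -> R (vapp v0 x) (vapp v1 x).
Proof.
  destruct 1; intros Hv; auto; exfalso;
    eauto using open_not_value, ctrl_not_value.
Qed.

Lemma rnf_app_fvar_inv R y z t : rnf R (app (fvar y) (fvar z)) t ->
  exists E a, t = eplug E (app (fvar y) a) /\ is_value a /\
    ctx_rel R Ehole E /\ rnf R (fvar z) a.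
Proof.
  intro H; inversion H as [? ? V0 _ _ | E0 E1 x v0 v1 O0 O1 V0 V1 HE Hv e | F0 F1 t0 t1 P0 P1 Hk e]; subst.
  - destruct V0.
  - destruct E0; simpl in e; inversion e; subst.
    + exists E1, v1; auto.
    + destruct E0; discriminate.
    + destruct E0; discriminate.
  - destruct F0; simpl in e; inversion e; subst; destruct F0; discriminate.
Qed.

(** Coinduction with [rnf R] itself as candidate: the simulation applied to the irreducible [y z]
    yields [E[y a]] with [z] and [a] again related by [rnf R]. *)
Lemma rnf_fvar_vrel R y w : rnf_simulation R -> lc w -> rnf R (fvar y) w ->
  vrel (cl R) (fvar y) w.
Proof.
  intros HR Hl H; apply vrel_fvar with (fun y w => lc w /\ rnf R (fvar y) w); auto.
  clear y w Hl H; intros y w [Hl H].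
  apply rnf_value_inv in H as [Hv H]; [|exact I].
  split; [auto|]; split; [auto|]. exists (fv (fvar y) ++ fv w); intros z Hz.
  destruct (HR _ _ (app (fvar y) (fvar z)) (H z Hz)) as (t & [Ht _] & Hnf).
  { apply eval_refl, (irreducible_open Ehole); exact I. }
  apply rnf_app_fvar_inv in Hnf as (E & a & -> & Va & HE & Ha).
  assert (Hst : star (app w (fvar z)) (eplug E (app (fvar y) a)))
    by (eapply rt_trans; [apply star_vapp|]; eauto).
  assert (HlE : lc (eplug E (app (fvar y) a)))
    by (eapply star_lc; eauto; split; auto; exact I).
  apply lc_eplug in HlE as [LE [_ La]].
  exists E, a; split; auto.
  apply ctx_rel_krel in HE as [(A0 & F0 & _ & _ & e & _) | (_ & PE & HJ)];
    [destruct A0; discriminate | | exact I | auto].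
  repeat split; auto.
Qed.

Lemma rnf_vrel R v0 v1 : rnf_simulation R -> rnf R v0 v1 -> is_value v0 -> lc v0 -> lc v1 ->
  vrel (cl R) v0 v1.
Proof.
  intros HR H V0 L0 L1.
  destruct v0 as [y| |t| | |]; try (simpl in V0; tauto); [apply rnf_fvar_vrel; auto|].
  apply rnf_value_inv in H as [V1 H]; auto.
  destruct (fresh_exists (fv (lam t) ++ fv v1)) as [z Hz].
  apply vrel_lam with z; auto.
  assert (Hl : lc (app v1 (fvar z))) by (split; auto; exact I).
  apply cl_star with (vapp v1 z); auto using star_vapp.
  apply cl_base; [exact (H z Hz) | |].
  - apply lc_open; auto; exact I.
  - eapply star_lc; eauto using star_vapp.
Qed.

Lemma rnf_nf R t0 t1 : rnf_simulation R -> rnf R t0 t1 -> lc t0 -> lc t1 -> nf (cl R) t0 t1.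
Proof.
  intros HR H L0 L1.
  destruct H as [v0 v1 V0 V1 H | E0 E1 x v0 v1 O0 O1 V0 V1 HE Hv | F0 F1 t0 t1 P0 P1 H].
  - apply nf_value, rnf_vrel; auto. constructor; auto.
  - apply lc_eplug in L0 as [LE0 [_ L0]], L1 as [LE1 [_ L1]].
    apply nf_open; auto using ctx_rel_krel, rnf_vrel.
  - destruct (fresh_exists (fv_ctx F0 ++ fv t0 ++ fv_ctx F1 ++ fv t1)) as [k Hk].
    apply nf_ctrl with k; auto.
    apply lc_eplug in L0 as [LF0 L0], L1 as [LF1 L1].
    apply cl_base; [exact (H k Hk) | |].
    + change (lc (open t0 (capture (EappR (fvar k) F0)))).
      apply lc_open; auto; apply lc_capture; split; auto; exact I.
    + change (lc (open t1 (capture (EappR (fvar k) F1)))).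
      apply lc_open; auto; apply lc_capture; split; auto; exact I.
Qed.

(** * Adequacy of the closure by double induction *)

(** In [<k []>] a value gives an open stuck term. A control stuck term captures [k F0] in one step,
    and the result is what [nf_ctrl] relates, up to the name of [k]; one step less remains for
    it. *)
Lemma cl_reset_app_adequate R n k t0 t1 :
  (forall m, m < n -> forall a b, cl R a b -> adequate R m a b) ->
  adequate R n t0 t1 ->
  adequate R n (reset (app (fvar k) t0)) (reset (app (fvar k) t1)).
Proof.
  intros IH Ht m r0 Hmn Hs Hr.
  set (K := Ereset (EappR (fvar k) Ehole)).
  assert (OK : ectx_ok K) by (repeat split).
  change (reset (app (fvar k) t0)) with (eplug K t0) in Hs.
  change (reset (app (fvar k) t1)) with (eplug K t1).
  apply nsteps_eplug_inv in Hs as (j & r' & Hj & Hs & Hr' & Hs'); auto.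
  destruct (Ht j r') as (r1 & [He Hi] & Hn); auto; [lia|].
  assert (Hst : star (eplug K t1) (eplug K r1)) by auto using star_eplug.
  destruct Hn as [v0 v1 Hvv | G0 G1 x v0 v1 OG0 OG1 HG Hvv | F0 F1 s0 s1 k' P0 P1 Hk Hc].
  - destruct (vrel_wf _ _ _ Hvv) as [[V0 _] [V1 _]].
    apply nsteps_irreducible in Hs' as [_ ->];
      [|apply (irreducible_open (Ereset Ehole)); auto; exact I].
    eexists; split; [split; [exact Hst | apply (irreducible_open (Ereset Ehole)); auto; exact I]|].
    apply (nf_open _ (Ereset Ehole) (Ereset Ehole)); auto; try exact I.
    left; exists Ehole, Ehole, Ehole, Ehole; repeat split; auto using jrel_hole.
    intros y _; apply cl_reset_fvar.
  - destruct (vrel_wf _ _ _ Hvv) as [[V0 _] [V1 _]].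
    rewrite <- eplug_ecomp in Hs', Hst.
    assert (O0 : ectx_ok (ecomp K G0)) by (apply ectx_ok_ecomp; auto).
    assert (O1 : ectx_ok (ecomp K G1)) by (apply ectx_ok_ecomp; auto).
    apply nsteps_irreducible in Hs' as [_ ->]; [|apply irreducible_open; auto].
    eexists; split; [split; [exact Hst | apply irreducible_open; auto]|].
    apply nf_open; auto. apply krel_reset_app; auto.
  - assert (Q0 : pure (EappR (fvar k) F0)) by (split; auto; exact I).
    assert (Q1 : pure (EappR (fvar k) F1)) by (split; auto; exact I).
    assert (S0 := step_shift Ehole (EappR (fvar k) F0) s0 I Q0).
    assert (S1 := step_shift Ehole (EappR (fvar k) F1) s1 I Q1).
    simpl in S0, S1, Hs', Hst.
    inversion Hs' as [? e1 e2 e3 | n' ? s ? Hs1 Hs2 e1 e2 e3]; subst.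
    { exfalso; apply Hr; eauto. }
    rewrite (step_det _ _ _ Hs1 S0) in Hs2.
    enough (Hen : exists r1, eval (reset (open s1 (capture (EappR (fvar k) F1)))) r1 /\ nf (cl R) r0 r1).
    { destruct Hen as (r1 & He1 & Hn); exists r1; split; auto.
      eapply eval_star; [exact Hst|]. eapply eval_star; [apply rt_step, S1|]; auto. }
    refine (IH (n - 1) _ _ _ _ n' r0 _ Hs2 Hr); try lia.
    apply nf_ctrl_any with k'; auto.
Qed.

(** Binders in [cl] close named atoms; opening such a body again is a substitution for the atom, so
    [cl_sb] applies. *)
Lemma sb_open_close x a t k : lc_at k t ->
  sb (upd idr x (RV a)) t (open_rec k a (close_rec k x t)).
Proof.
  revert k; induction t; simpl; intros k Hk; try (constructor; auto; fail).
  - destruct (Nat.eqb_spec x0 x) as [-> | Hx]; simpl.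
    + rewrite Nat.eqb_refl; apply sb_upd_fvar.
    + constructor; rewrite upd_neq; auto.
  - destruct (Nat.eqb_spec n k); [lia | constructor].
  - destruct Hk; constructor; auto.
Qed.

Lemma cl_open_close R x t0 t1 v0 v1 : cl R t0 t1 -> vrel (cl R) v0 v1 ->
  cl R (open (close x t0) v0) (open (close x t1) v1).
Proof.
  intros H Hv; destruct (cl_lc _ _ _ H) as [L0 L1].
  apply (cl_subst R (upd idr x (RV v0)) (upd idr x (RV v1)) _ _ _ _ H).
  - apply rrel_upd; [intro; apply rrel_idr | constructor; auto].
  - apply sb_open_close; auto.
  - apply sb_open_close; auto.
Qed.

Lemma vrel_capture_fvar R k :
  vrel (cl R) (capture (EappR (fvar k) Ehole)) (capture (EappR (fvar k) Ehole)).
Proof.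
  set (v := capture (EappR (fvar k) Ehole)).
  assert (Lv : lc v) by (apply lc_capture; repeat split).
  destruct (fresh_exists (fv v ++ fv v)) as [z Hz].
  apply vrel_lam with z; auto; try exact I.
  apply cl_star with (reset (app (fvar k) (fvar z))).
  - apply cl_reset_app, cl_fvar.
  - split; auto; exact I.
  - apply rt_step, step_beta_top; exact I.
Qed.

Lemma cl_adequate R n t0 t1 : rnf_simulation R -> cl R t0 t1 -> adequate R n t0 t1.
Proof.
  intro HR; revert t0 t1; induction n as [n IH] using lt_wf_ind; intros t0 t1 H.
  induction H as [t0 t1 H L0 L1 | x | x y | x | x t0 t1 H _ | x t0 t1 H _
    | k t0 t1 H IHt | t0 t1 t1' H IHt L1 Hs | x E0 E1 t0 t1 O0 O1 Hx HE IHE H IHt Hm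
    | rho0 rho1 t0 t1 u0 u1 H IHt H0 H1 Hwf HkF HkV HV HF IHF].
  - intros m r0 _ Hs Hr. apply nsteps_star in Hs.
    destruct (HR t0 t1 r0 H) as (r1 & [Hs1 Hi1] & Hn); [split; auto|].
    exists r1; split; [split; auto|].
    apply rnf_nf; auto; eapply star_lc; eauto.
  - apply adequate_irreducible with (fvar x);
      try apply eval_refl; try (apply irreducible_value; exact I).
    apply nf_value, vrel_fvar_refl.
  - assert (Hi := irreducible_open Ehole x (fvar y) I I).
    apply adequate_irreducible with (app (fvar x) (fvar y)); auto using eval_refl.
    apply (nf_open _ Ehole Ehole); try exact I; auto using vrel_fvar_refl.
    right; repeat split; auto using jrel_hole.
  - assert (Hx := step_reset Ehole (fvar x) I I); simpl in Hx.
    intros m r0 _ Hs Hr.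
    inversion Hs as [? e1 e2 e3 | n' ? s ? Hs1 Hs2 e1 e2 e3]; subst.
    { exfalso; apply Hr; eauto. }
    rewrite (step_det _ _ _ Hs1 Hx) in Hs2.
    apply nsteps_irreducible in Hs2 as [_ ->]; [|apply irreducible_value; exact I].
    exists (fvar x); split; [|apply nf_value, vrel_fvar_refl].
    split; [apply rt_step; auto | apply irreducible_value; exact I].
  - apply adequate_irreducible with (lam (close x t1));
      try apply eval_refl; try (apply irreducible_value; exact I).
    apply nf_value.
    destruct (cl_lc _ _ _ H) as [L0 L1].
    destruct (fresh_exists (fv (close x t0) ++ fv (lam (close x t1)))) as [z Hz].
    apply vrel_lam with z; auto; try exact I; try (apply lc_at_close; auto).
    apply cl_star with (open (close x t1) (fvar z)).
    + apply cl_open_close; auto using vrel_fvar_refl.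
    + split; [apply lc_at_close; auto | exact I].
    + apply rt_step, step_beta_top; exact I.
  - assert (Hi : forall t, irreducible (shift t)) by (intro; apply (irreducible_ctrl Ehole); exact I).
    apply adequate_irreducible with (shift (close x t1)); auto using eval_refl.
    destruct (fresh_exists (fv (close x t0) ++ fv (close x t1))) as [k Hk].
    apply (nf_ctrl _ Ehole Ehole) with k; auto; try exact I.
    apply cl_reset, cl_open_close; auto using vrel_capture_fvar.
  - apply cl_reset_app_adequate; auto.
  - intros m r0 Hm Hn Hr. destruct (IHt m r0 Hm Hn Hr) as (r1 & He & Hnf).
    exists r1; split; auto. eapply eval_star; eauto.
  - assert (HJ : jrel (cl R) E0 E1) by (apply jrel_intro with x; auto).
    apply adequate_plug; auto.
    intros m v0 v1 Hmn _ Hv. apply adequate_mono with n; [lia|].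
    (* [E0[v0]] is [E0[x]] with [v0] put for [x], and the inner induction already provides the
       adequacy of [E0[x]]. *)
    apply (adequate_sb R n (upd idr x (RV v0)) (upd idr x (RV v1)) _ _ _ _ IH) with (3 := IHE).
    + apply rrel_upd; [intro; apply rrel_idr | constructor; auto].
    + intros y F0 F1 a0 a1 e; unfold upd, idr in e; destruct (Nat.eqb y x); discriminate.
    + apply sb_subst; fresh_in.
    + apply sb_subst; fresh_in.
  - assert (Hr : forall y, rrel (cl R) (rho0 y) (rho1 y)).
    { intro y; destruct (Hwf y) as [W0 W1], (rho0 y) as [v0|F0] eqn:e0.
      - destruct (HkV y _ e0) as [v1 e1]; rewrite e1; constructor; eauto.
      - destruct (HkF y _ e0) as [F1 e1]; rewrite e1 in *; simpl in W0, W1.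
        constructor; try tauto. exact (HF y _ _ e0 e1). }
    apply adequate_sb with rho0 rho1 t0 t1; auto.
    (* A frame meeting a value is an instance of [<F0[x]>], for which the inner induction provides
       [IHF]. The substitution used here replaces no frames, so the argument stops. *)
    intros y F0 F1 a0 a1 e0 e1 Ha.
    destruct (fresh_exists (fv_ctx F0 ++ fv_ctx F1)) as [x Hx].
    apply (adequate_sb R n (upd idr x (RV a0)) (upd idr x (RV a1)) _ _ _ _ IH)
      with (3 := IHF y F0 F1 e0 e1 x Hx).
    + apply rrel_upd; [intro; apply rrel_idr | constructor; auto].
    + intros y' G0 G1 c0 c1 e; unfold upd, idr in e; destruct (Nat.eqb y' x); discriminate.
    + apply (sb_subst x a0 (Ereset F0)); fresh_in.
    + apply (sb_subst x a1 (Ereset F1)); fresh_in.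
Qed.

(** * General contexts and soundness *)

(** [cl] relates locally closed terms only, while the parts of a general context may have dangling
    indices. These are named through [f]; [g] renames the atoms, which keeps captured names
    apart. *)
Fixpoint inst (k : nat) (f g : nat -> nat) (t : term) : term :=
  match t with
  | fvar x => fvar (g x)
  | bvar n => if n <? k then bvar n else fvar (f (n - k))
  | lam t => lam (inst (S k) f g t)
  | app t u => app (inst k f g t) (inst k f g u)
  | shift t => shift (inst (S k) f g t)
  | reset t => reset (inst k f g t)
  end.

Lemma sb_inst k f g t : lc_at k t -> sb (fun x => RV (fvar (g x))) t (inst k f g t).
Proof.
  revert k; induction t; simpl; intros k Hk; try (constructor; auto; fail).
  - apply Nat.ltb_lt in Hk as ->; constructor.
  - destruct Hk; constructor; auto.
Qed.

(* [z] is a fresh name standing for the variable [x] that the binder captures,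
   so that [f] and [g] may safely mention [x]. *)
Lemma inst_close k f g x z t :
  ~ In z (fv (inst (S k) f g (close_rec k x t))) ->
  inst (S k) f g (close_rec k x t) =
  close_rec k z (inst k (fun n => match n with 0 => z | S n => f n end)
                        (fun y => if Nat.eqb y x then z else g y) t).
Proof.
  revert k; induction t; simpl; intros k Hz;
    try (f_equal; auto; fail).
  - destruct (Nat.eqb_spec x0 x) as [-> | Hx]; simpl in *.
    + rewrite Nat.eqb_refl, (proj2 (Nat.ltb_lt k (S k))); auto.
    + destruct (Nat.eqb_spec (g x0) z); auto; tauto.
  - destruct (Nat.ltb_spec n k).
    + rewrite (proj2 (Nat.ltb_lt n (S k))); auto.
    + destruct (Nat.ltb_spec n (S k)).
      * replace (n - k) with 0 by lia; simpl; rewrite Nat.eqb_refl; f_equal; lia.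
      * replace (n - k) with (S (n - S k)) by lia; simpl in *.
        destruct (Nat.eqb_spec (f (n - S k)) z); auto; tauto.
  - rewrite in_app_iff in Hz; f_equal; auto.
Qed.

Lemma inst_lc k f t : lc_at k t -> inst k f (fun x => x) t = t.
Proof.
  revert k; induction t; simpl; intros k Hk; try (f_equal; auto; fail).
  - apply Nat.ltb_lt in Hk as ->; auto.
  - destruct Hk; f_equal; auto.
Qed.

Lemma close_rec_fresh k x t : ~ In x (fv t) -> close_rec k x t = t.
Proof.
  revert k; induction t; simpl; intros k Hx; try (f_equal; auto; fail).
  - destruct (Nat.eqb_spec x0 x); tauto.
  - rewrite in_app_iff in Hx; f_equal; auto.
Qed.

Lemma cl_inst_close R x t0 t1 :
  (forall f g, cl R (inst 0 f g t0) (inst 0 f g t1)) -> forall f g,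
  exists z u0 u1, cl R u0 u1 /\
    inst 1 f g (close x t0) = close z u0 /\ inst 1 f g (close x t1) = close z u1.
Proof.
  intros H f g.
  destruct (fresh_exists (fv (inst 1 f g (close x t0)) ++ fv (inst 1 f g (close x t1))))
    as [z Hz].
  unfold close in *; rewrite !inst_close with (z := z) by fresh_in.
  do 3 eexists; split; [apply H | auto].
Qed.

Lemma cl_inst_refl R t : forall f g, cl R (inst 0 f g t) (inst 0 f g t).
Proof.
  induction t; intros f g; simpl; auto using cl_fvar, cl_app, cl_reset;
  (* Closing over an absent name is the identity, which brings the body of a binder into the form
     that [cl_inst_close] expects. *)
  destruct (fresh_exists (fv t)) as [x Hx];
  destruct (cl_inst_close R x t t IHt f g) as (z & u0 & u1 & Hu & e0 & e1);
  unfold close at 1 in e0; rewrite close_rec_fresh in e0 by auto;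
  unfold close at 1 in e1; rewrite close_rec_fresh in e1 by auto.
  - assert (Hl := cl_lam _ z _ _ Hu). rewrite <- e0, <- e1 in Hl; auto.
  - assert (Hl := cl_shift _ z _ _ Hu). rewrite <- e0, <- e1 in Hl; auto.
Qed.

(* The terms in a context [C] may contain dangling indices bound by [C], which
   is why the statement ranges over all instantiations. *)
Lemma cl_cplug R C t0 t1 : cl R t0 t1 -> forall f g,
  cl R (inst 0 f g (cplug C t0)) (inst 0 f g (cplug C t1)).
Proof.
  intro H; induction C; simpl; intros f g; auto using cl_app, cl_reset, cl_inst_refl.
  - destruct (cl_lc _ _ _ H).
    apply (cl_subst R (fun x => RV (fvar (g x))) (fun x => RV (fvar (g x))) _ _ _ _ H);
      auto using sb_inst, rrel_fvar.
  - destruct (cl_inst_close R x _ _ IHC f g) as (z & u0 & u1 & Hu & -> & ->).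
    apply cl_lam; auto.
  - destruct (cl_inst_close R k _ _ IHC f g) as (z & u0 & u1 & Hu & -> & ->).
    apply cl_shift; auto.
Qed.

Lemma cl_adequate_value R t0 t1 : rnf_simulation R -> cl R t0 t1 ->
  evals_to_value t0 -> evals_to_value t1.
Proof.
  intros HR H (v & [Hs Hi] & Hv). apply star_nsteps in Hs as [n Hn].
  destruct (cl_adequate R n t0 t1 HR H n v) as (r & He & Hnf); auto.
  exists r; split; auto.
  destruct Hnf as [v0 v1 Hvv | |]; [apply (vrel_wf _ _ _ Hvv) | |];
    exfalso; eauto using open_not_value, ctrl_not_value.
Qed.

Lemma cl_adequate_ctrl R t0 t1 : rnf_simulation R -> cl R t0 t1 ->
  evals_to_control_stuck t0 -> evals_to_control_stuck t1.
Proof.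
  intros HR H (v & [Hs Hi] & F & u & PF & ->). apply star_nsteps in Hs as [n Hn].
  destruct (cl_adequate R n t0 t1 HR H n _ (le_n _) Hn Hi) as (r & He & Hnf).
  exists r; split; auto.
  inversion Hnf as [v0 v1 Hvv e | E0 E1 x v0 v1 O0 O1 HE Hvv e | F0 F1 s0 s1 k P0 P1]; subst.
  - destruct (vrel_wf _ _ _ Hvv) as [[V0 _] _]. exfalso; eauto using ctrl_not_value.
  - destruct (vrel_wf _ _ _ Hvv) as [[V0 _] _]. exfalso; eauto using open_not_ctrl.
  - exists F1, s1; auto.
Qed.

(** One-sided adequacy is applied to [R] and to its inverse. Closed programs are locally closed, so
    instantiating them with the identity changes nothing. *)
Lemma rnf_bisim_ctx_equiv t0 t1 : lc t0 -> lc t1 -> rnf_bisim t0 t1 -> ctx_equiv t0 t1.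
Proof.
  intros L0 L1 (R & [HR HR'] & H) C [LC0 _] [LC1 _].
  assert (Hcl : forall (S : rel) s0 s1, S s0 s1 -> lc s0 -> lc s1 ->
    lc (cplug C s0) -> lc (cplug C s1) -> cl S (cplug C s0) (cplug C s1)).
  { intros S s0 s1 HS l0 l1 lC0 lC1.
    rewrite <- (inst_lc 0 (fun x => x) (cplug C s0)), <- (inst_lc 0 (fun x => x) (cplug C s1))
      by auto.
    apply cl_cplug, cl_base; auto. }
  split; split.
  - apply (cl_adequate_value R); auto.
  - apply (cl_adequate_value (fun a b => R b a)); auto.
  - apply (cl_adequate_ctrl R); auto.
  - apply (cl_adequate_ctrl (fun a b => R b a)); auto.
Qed.

(** * Strictness *)

Definition omega : term :=
  app (lam (app (bvar 0) (bvar 0))) (lam (app (bvar 0) (bvar 0))).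

Lemma omega_step t : step omega t -> t = omega.
Proof.
  intro H; apply (step_det omega); auto. apply step_beta_top; exact I.
Qed.

(* [bvar] is allowed so that the class is stable under opening and closing. *)
Definition silent (t : term) : Prop :=
  match t with
  | app _ _ | shift _ => False
  | _ => True
  end.

Lemma silent_step t t' : step t t' -> silent t -> silent t'.
Proof.
  intros H Hd; destruct t; simpl in Hd; try tauto;
    try (inversion H; destruct E; discriminate).
  assert (Hr := delimited_step _ _ H I); destruct t'; simpl in *; auto.
Qed.

(** An invariant of reduction that excludes values and control stuck terms. A closed member does
    diverge, but the open stuck term [<x x> Omega] belongs to the class as well. *)
Inductive diverging : term -> Prop :=
| div_omega a : silent a -> diverging (app a omega)
| div_appL t u : diverging t -> diverging (app t u)
| div_appR v t : is_value v -> diverging t -> diverging (app v t)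
| div_reset t : diverging t -> diverging (reset t).

Lemma diverging_not_value t : diverging t -> is_value t -> False.
Proof. destruct 1; simpl; auto. Qed.

Lemma ctrl_not_omega F t : eplug F (shift t) <> omega.
Proof.
  destruct F as [|v F | F u|]; try discriminate; intro e; inversion e;
    destruct F; discriminate.
Qed.

Lemma diverging_not_ctrl F t : pure F -> diverging (eplug F (shift t)) -> False.
Proof.
  induction F as [| v F IH | F IH u |]; simpl; intros HF H; auto.
  - inversion H.
  - destruct HF as [Hv HF]; inversion H; subst.
    + now apply (ctrl_not_omega F t).
    + eauto using diverging_not_value.
    + auto.
  - inversion H; subst.
    + destruct F; simpl in *; auto.
    + auto.
    + eauto using ctrl_not_value.
Qed.

Lemma diverging_step t t' : diverging t -> step t t' -> diverging t'.
Proof.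
  intro H; revert t'; induction H as [a Ha | t u H IH | v t Hv H IH | t H IH]; intros t' Hs.
  - apply step_app_inv in Hs as [(s & -> & [] & _) | [(a' & Hs & ->) | (Hv & b' & Hs & ->)]].
    + apply div_omega; eauto using silent_step.
    + apply omega_step in Hs as ->. apply div_omega; auto.
  - apply step_app_inv in Hs as [(s & -> & _) | [(a' & Hs & ->) | (Hv & _)]].
    + inversion H.
    + apply div_appL; auto.
    + exfalso; eauto using diverging_not_value.
  - apply step_app_inv in Hs as [(s & -> & Hv' & _) | [(a' & Hs & ->) | (_ & b' & Hs & ->)]].
    + exfalso; eauto using diverging_not_value.
    + exfalso; eauto using value_no_step.
    + apply div_appR; auto.
  - apply step_reset_inv in Hs as [(Hv & _) | [(F & u & PF & -> & _) | (a' & Hs & ->)]].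
    + exfalso; eauto using diverging_not_value.
    + exfalso; eauto using diverging_not_ctrl.
    + apply div_reset; auto.
Qed.

Lemma diverging_nsteps n t t' : diverging t -> nsteps n t t' -> diverging t'.
Proof. induction 2; eauto using diverging_step. Qed.

(** The compatible closure of exchanging [a Omega] and [b Omega] for silent [a] and [b]. *)
Inductive omega_rel : term -> term -> Prop :=
| or_omega a b : silent a -> silent b -> omega_rel (app a omega) (app b omega)
| or_fvar x : omega_rel (fvar x) (fvar x)
| or_bvar n : omega_rel (bvar n) (bvar n)
| or_lam t u : omega_rel t u -> omega_rel (lam t) (lam u)
| or_app t u t' u' : omega_rel t u -> omega_rel t' u' -> omega_rel (app t t') (app u u')
| or_shift t u : omega_rel t u -> omega_rel (shift t) (shift u)
| or_reset t u : omega_rel t u -> omega_rel (reset t) (reset u).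

Lemma omega_rel_refl t : omega_rel t t.
Proof. induction t; try (constructor; auto; fail); apply or_app; auto. Qed.

Lemma omega_rel_sym t u : omega_rel t u -> omega_rel u t.
Proof. induction 1; try (constructor; auto; fail); apply or_app; auto. Qed.

Lemma silent_close k x t : silent t -> silent (close_rec k x t).
Proof. destruct t; simpl; auto. destruct (Nat.eqb x0 x); simpl; auto. Qed.

Lemma silent_open k v t : is_value v -> silent t -> silent (open_rec k v t).
Proof.
  destruct t; simpl; auto. destruct (Nat.eqb n k); simpl; auto.
  destruct v; simpl; tauto.
Qed.

Lemma omega_rel_close x t u : omega_rel t u -> forall k,
  omega_rel (close_rec k x t) (close_rec k x u).
Proof.
  induction 1; intro k; try apply omega_rel_refl; simpl.
  - apply (or_omega (close_rec k x a) (close_rec k x b)); auto using silent_close.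
  - apply or_lam; auto.
  - apply or_app; auto.
  - apply or_shift; auto.
  - apply or_reset; auto.
Qed.

Lemma omega_rel_value t u : omega_rel t u -> is_value t -> is_value u.
Proof. destruct 1; simpl; auto. Qed.

Lemma omega_rel_open v w t u : is_value v -> omega_rel v w -> omega_rel t u -> forall k,
  omega_rel (open_rec k v t) (open_rec k w u).
Proof.
  intros Hv Hvw; assert (Hw := omega_rel_value _ _ Hvw Hv).
  induction 1; intro k; simpl; try (constructor; auto; fail).
  - apply (or_omega (open_rec k v a) (open_rec k w b)); auto using silent_open.
  - destruct (Nat.eqb n k); auto; constructor.
Qed.

(** In an [or_omega] pair the [shift] would sit in [omega] or in a silent term, which is impossible,
    so the two contexts have the same shape. *)
Lemma omega_rel_ctrl F t u : pure F -> omega_rel (eplug F (shift t)) u ->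
  exists G s, pure G /\ u = eplug G (shift s) /\ omega_rel t s /\
    forall a b, omega_rel a b -> omega_rel (eplug F a) (eplug G b).
Proof.
  revert u; induction F; simpl; intros u HF H; try tauto.
  - inversion H; subst. exists Ehole; simpl; eauto.
  - destruct HF as [Hv HF]; inversion H as [| | | |? w ? r H1 H2| |]; subst.
    + exfalso; eapply ctrl_not_omega; eauto.
    + destruct (IHF _ HF H2) as (G & s & HG & -> & Hs & HFG).
      exists (EappR w G), s; repeat split; eauto using omega_rel_value.
      intros; apply or_app; auto.
  - inversion H as [| | | |? w ? r H1 H2| |]; subst.
    + exfalso; apply (diverging_not_ctrl (EappL F omega) t HF), div_omega; auto.
    + destruct (IHF _ HF H1) as (G & s & HG & -> & Hs & HFG).
      exists (EappL G r), s; repeat split; auto.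
      intros; apply or_app; auto.
Qed.

(** A step inside an exchanged pair in evaluation position shows the whole term to be [diverging].
    Every other step leaves the pairs intact or substitutes into them, and is matched by one
    step. *)
Lemma omega_rel_step t u t' : omega_rel t u -> step t t' ->
  diverging t \/ exists u', step u u' /\ omega_rel t' u'.
Proof.
  intro H; revert t'; induction H as [a b Ha Hb | | | | t u s r H IH H' IH' | | t u H IH];
    intros t' Hs; try (inversion Hs; destruct E; discriminate).
  - left; apply div_omega; auto.
  - apply step_app_inv in Hs as [(t0 & -> & Hv & ->) | [(a' & Hs & ->) | (Hv & b' & Hs & ->)]].
    + inversion H; subst. right; eexists; split.
      * apply step_beta_top; eauto using omega_rel_value.
      * apply omega_rel_open; auto.
    + destruct (IH _ Hs) as [Hd | (u' & Hu & Hr)]; [left; apply div_appL; auto | right].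
      exists (app u' r); split; [apply (step_eplug (EappL Ehole r)); simpl; auto | apply or_app; auto].
    + destruct (IH' _ Hs) as [Hd | (u' & Hu & Hr)]; [left; apply div_appR; auto | right].
      exists (app u u'); split; [|apply or_app; auto].
      apply (step_eplug (EappR u Ehole)); simpl; eauto using omega_rel_value.
  - apply step_reset_inv in Hs as [(Hv & ->) | [(F & s & PF & -> & ->) | (a' & Hs & ->)]].
    + right; exists u; split; auto. apply (step_reset Ehole); [exact I|].
      eauto using omega_rel_value.
    + destruct (omega_rel_ctrl _ _ _ PF H) as (G & s' & PG & -> & Hs & HFG).
      right; eexists; split; [apply (step_shift Ehole); auto; exact I|].
      apply or_reset, omega_rel_open; auto; [exact I|].
      apply or_lam, or_reset, HFG, or_bvar.
    + destruct (IH _ Hs) as [Hd | (u' & Hu & Hr)]; [left; apply div_reset; auto | right].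
      exists (reset u'); split; [apply (step_eplug (Ereset Ehole)); simpl; auto | apply or_reset; auto].
Qed.

Lemma omega_rel_nsteps n t u t' : omega_rel t u -> nsteps n t t' ->
  diverging t' \/ exists u', star u u' /\ omega_rel t' u'.
Proof.
  intros H Hn; revert u H; induction Hn as [t | n t t1 t2 Hs Hn IH]; intros u H.
  - right; exists u; split; [apply rt_refl | auto].
  - destruct (omega_rel_step _ _ _ H Hs) as [Hd | (u' & Hu & Hr)].
    + left; eauto using diverging_step, diverging_nsteps.
    + destruct (IH _ Hr) as [Hd | (u2 & Hu2 & Hr2)]; auto.
      right; exists u2; split; auto. eapply rt_trans; [apply rt_step|]; eauto.
Qed.

Lemma omega_rel_evals t u : omega_rel t u ->
  (evals_to_value t -> evals_to_value u) /\
  (evals_to_control_stuck t -> evals_to_control_stuck u).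
Proof.
  intro H; split.
  - intros (v & [Hs Hi] & Hv). apply star_nsteps in Hs as [n Hn].
    destruct (omega_rel_nsteps _ _ _ _ H Hn) as [Hd | (u' & Hu & Hr)].
    { exfalso; eauto using diverging_not_value. }
    assert (Hv' := omega_rel_value _ _ Hr Hv).
    exists u'; split; auto; split; auto using irreducible_value.
  - intros (v & [Hs Hi] & F & s & PF & ->). apply star_nsteps in Hs as [n Hn].
    destruct (omega_rel_nsteps _ _ _ _ H Hn) as [Hd | (u' & Hu & Hr)].
    { exfalso; eauto using diverging_not_ctrl. }
    destruct (omega_rel_ctrl _ _ _ PF Hr) as (G & s' & PG & -> & _).
    exists (eplug G (shift s')); split; [split; auto using irreducible_ctrl|].
    exists G, s'; auto.
Qed.

Lemma omega_rel_cplug C t u : omega_rel t u -> omega_rel (cplug C t) (cplug C u).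
Proof.
  intro H; induction C; simpl; auto using omega_rel_refl, or_app, or_reset.
  - apply or_lam, omega_rel_close; auto.
  - apply or_shift, omega_rel_close; auto.
Qed.

Lemma omega_rel_ctx_equiv t u : omega_rel t u -> ctx_equiv t u.
Proof.
  intros H C _ _; apply (omega_rel_cplug C) in H.
  destruct (omega_rel_evals _ _ H), (omega_rel_evals _ _ (omega_rel_sym _ _ H)).
  split; split; auto.
Qed.

Lemma app_fvar_omega_not_eval x t : ~ eval (app (fvar x) omega) t.
Proof.
  intros [Hs Hi].
  assert (Hloop : step (app (fvar x) omega) (app (fvar x) omega)).
  { apply (step_eplug (EappR (fvar x) Ehole)); [repeat split|].
    apply step_beta_top; exact I. }
  apply star_nsteps in Hs as [n Hn].
  remember (app (fvar x) omega) as s eqn:e; induction Hn as [s | n s s1 s2 Hs Hn IH]; subst.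
  - apply Hi; eauto.
  - rewrite (step_det _ _ _ Hs Hloop) in IH; auto.
Qed.

Theorem theorem2 :
  (forall t0 t1 : term, lc t0 -> lc t1 -> rnf_bisim t0 t1 -> ctx_equiv t0 t1) /\
  (exists t0 t1 : term, lc t0 /\ lc t1 /\ ctx_equiv t0 t1 /\ ~ rnf_bisim t0 t1).
Proof.
  split; [exact rnf_bisim_ctx_equiv|].
  exists (app (fvar 0) omega), (app (reset (app (fvar 0) (fvar 0))) omega).
  split; [cbv; lia|]; split; [cbv; lia|]; split.
  - apply omega_rel_ctx_equiv, or_omega; exact I.
  - intros (R & [_ HR] & H).
    (* The second term is itself open stuck, so the inverse simulation would make the first one
       terminate. *)
    destruct (HR _ _ (app (reset (app (fvar 0) (fvar 0))) omega) H) as (t & He & _).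
    + apply eval_refl, (irreducible_open (EappL (Ereset Ehole) omega)); exact I.
    + apply app_fvar_omega_not_eval in He; auto.
Qed.
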